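(* Let $d\ge1$ and let $(\lambda_k)_{k\ge1}$ be the nonzero eigenvalues, repeated according to multiplicity, of the operator $T_d$ on $L^2(I_d,\nu_d)$ given by $(T_df)(j)=\int_{I_d}K_d(j,l)f(l)\,d\nu_d(l)$. Then $\lambda_k\ge0$ for all $k$ and $$\sum_{k=1}^\infty\lambda_k=\operatorname{tr}(T_d)=\int_{I_d}K_d(j,j)\,d\nu_d(j)=2^{-d}-3^{-d}.$$
   Context: $\mathrm{Corner}(d)$ is the set of all $2^d$ functions $c:\{0,\dots,d-1\}\to\{\mathrm{true},\mathrm{false}\}$, and $I_d=\mathrm{Corner}(d)\times[0,1]^d$ carries the probability measure $\nu_d=2^{-d}\sum_{c}\delta_c\otimes dx$ ($dx$ Lebesgue measure). For $j=(c,p)\in I_d$ let $A_j=\{s\in[0,1]^d:\ \text{for all }k,\ s_k\ge p_k\text{ if }c(k)=\mathrm{true},\ s_k\le p_k\text{ if }c(k)=\mathrm{false}\}$. With $P_0$ the uniform measure on $[0,1]^d$, $K_d(j,l)=P_0(A_j\cap A_l)-P_0(A_j)P_0(A_l)$. The operator $T_d$ is a positive, self-adjoint, trace-class operator. *)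

(* Defs.v *)
From HB Require Import structures.
From mathcomp Require Import all_boot all_order all_algebra.
From mathcomp Require Import all_classical all_reals all_analysis.

Set Implicit Arguments.
Unset Strict Implicit.
Unset Printing Implicit Defensive.

Import Order.TTheory GRing.Theory Num.Theory numFieldNormedType.Exports.

Local Open Scope classical_set_scope.
Local Open Scope ring_scope.

(** Operators on the real Hilbert space L^2(mu), given as maps on functions that
    respect mu-almost everywhere equality.  Elements of L^2(mu) are
    represented by functions in [Lfun mu 2%:E] (measurable, of finite 2-norm);
    identities between them hold mu-almost everywhere. *)
Section L2_operators.
Context {disp : measure_display} {X : measurableType disp} {R : realType}.
Variable mu : {measure set X -> \bar R}.

Definition L2dot (f g : X -> R) : R := \int[mu]_x (f x * g x).

(* The third clause is the norm convergence f = \sum_k <f, e_k> e_k. *)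
Definition orthonormal_basis (e : nat -> X -> R) : Prop :=
  [/\ forall n, e n \in Lfun mu 2%:E,
      forall m n, L2dot (e m) (e n) = (m == n)%:R
    & forall f, f \in Lfun mu 2%:E ->
        'N[mu]_2%:E[EFin \o
          (fun x => f x - \sum_(k < n) L2dot f (e k) * e k x)%R]%E
          @[n --> \oo] --> 0%E].

Definition integral_operator (K : X -> X -> R) (f : X -> R) : X -> R :=
  fun x => \int[mu]_y (K x y * f y).

(* The trace is the sum of the <A e_n, e_n>, for every orthonormal basis e.
   The first clause prevents vacuity on spaces without such a basis. *)
Definition has_trace (A : (X -> R) -> X -> R) (t : R) : Prop :=
  (exists e, orthonormal_basis e) /\
  forall e, orthonormal_basis e ->
    series (fun n => L2dot (A (e n)) (e n)) @ \oo --> t.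

Definition in_eigenspace (A : (X -> R) -> X -> R) (x : R) (f : X -> R) : Prop :=
  f \in Lfun mu 2%:E /\ {ae mu, forall y, A f y = x * f y}.

(* The eigenspace of x, modulo mu-a.e. equality, has a basis of n elements;
   n = 0 means that x is not an eigenvalue. *)
Definition has_multiplicity (A : (X -> R) -> X -> R) (x : R) (n : nat) : Prop :=
  exists e : 'I_n -> X -> R,
  [/\ forall i, in_eigenspace A x (e i),
      forall a : 'I_n -> R,
        {ae mu, forall y, \sum_(i < n) a i * e i y = 0} -> forall i, a i = 0
    & forall f, in_eigenspace A x f ->
        exists a : 'I_n -> R,
          {ae mu, forall y, f y = \sum_(i < n) a i * e i y}].

(* Every nonzero real x occurs in the sequence lam exactly as many times as the
   dimension of its eigenspace (so not at all if x is not an eigenvalue). *)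
Definition enumerates_nonzero_eigenvalues
    (A : (X -> R) -> X -> R) (lam : nat -> R) : Prop :=
  (forall k, lam k != 0) /\
  forall x, x != 0 ->
    exists2 n, has_multiplicity A x n & ([set k | lam k = x] #= `I_n)%card.

End L2_operators.

(** The uniform measure P_0 on [0,1]^d, i.e. Lebesgue measure dx on [0,1]^d, as
    a probability on d-tuples of reals concentrated on the cube: the d-fold
    product of the uniform measure on [0,1]. *)
Section cube_measure.
Context {R : realType}.
Local Notation TR := (measurableTypeR R).

Definition tuple_consf (n : nat) (x : TR * n.-tuple TR) : n.+1.-tuple TR :=
  [the n.+1.-tuple TR of x.1 :: x.2].

Lemma measurable_tuple_consf n : measurable_fun setT (@tuple_consf n).
Proof. exact: measurable_cons. Qed.

HB.instance Definition _ n := isMeasurableFun.Build _ _ _ _ (@tuple_consf n)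
  (@measurable_tuple_consf n).

Definition unif01 : probability TR R := uniform_prob (@ltr01 R).

Fixpoint cube_prob (d : nat) : probability (d.-tuple TR) R :=
  match d with
  | 0 => \d_([tuple])
  | n.+1 => distribution (unif01 \x cube_prob n)%E (@tuple_consf n)
  end.

End cube_measure.
Arguments cube_prob {R} d.

(** I_d = Corner(d) x [0,1]^d, a corner c being the tuple of its values c(k).
    The points (c, p) with p outside the cube form a null set for the measure
    [nu] below, so that L^2(nu) is L^2(I_d, nu_d). *)
Definition index_space (R : realType) (d : nat) :=
  (d.-tuple bool * d.-tuple (measurableTypeR R))%type.

Section corner_measure.
Context {R : realType}.
Variable d : nat.
Local Open Scope ereal_scope.

Definition nu (A : set (index_space R d)) : \bar R :=
  (2 ^- d)%R%:E * \sum_(c : d.-tuple bool) (\d_c \x cube_prob d) A.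

Let nu0 : nu set0 = 0.
Proof. by rewrite /nu big1 ?mule0// => c _; rewrite measure0. Qed.

Let nu_ge0 A : 0 <= nu A.
Proof.
by rewrite /nu mule_ge0 ?sume_ge0// lee_fin invr_ge0 exprn_ge0.
Qed.

Let nu_sigma_additive : semi_sigma_additive nu.
Proof.
move=> F mF tF mUF.
rewrite [X in X @ _ --> _](_ : _ = fun n => (2 ^- d)%R%:E *
  \sum_(c : d.-tuple bool) \sum_(0 <= i < n) (\d_c \x cube_prob d) (F i)); last first.
  apply/funext => n; rewrite exchange_big/= ge0_sume_distrr// => i _.
  exact: sume_ge0.
apply: cvgeZl => //; apply: cvg_nnesum => c _.
  by apply: nearW => n; exact: sume_ge0.
exact: measure_semi_sigma_additive.
Qed.

HB.instance Definition _ := isMeasure.Build _ _ _ nu nu0 nu_ge0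
  nu_sigma_additive.

Let nu_setT : nu setT = 1.
Proof.
rewrite /nu (eq_bigr (fun=> 1)) => [|c _]; last exact: probability_setT.
by rewrite sumEFin sumr_const card_tuple card_bool -EFinM natrX mulVf.
Qed.

HB.instance Definition _ := Measure_isProbability.Build _ _ _ nu nu_setT.

End corner_measure.
Arguments nu {R} d A.

Section kernel.
Context {R : realType} {d : nat}.

(* the set A_j *)
Definition anchored_box (j : index_space R d) :
    set (d.-tuple (measurableTypeR R)) :=
  [set s | forall k : 'I_d, 0 <= tnth s k <= 1 /\
    (if tnth j.1 k then tnth j.2 k <= tnth s k else tnth s k <= tnth j.2 k)].

Definition Kd (j l : index_space R d) : R :=
  fine (cube_prob d (anchored_box j `&` anchored_box l))
  - fine (cube_prob d (anchored_box j)) * fine (cube_prob d (anchored_box l)).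

End kernel.

Definition Td (R : realType) (d : nat) :
    (index_space R d -> R) -> index_space R d -> R :=
  integral_operator (nu d) Kd.

(* Main.v *)
Require Import Defs.
From mathcomp Require Import all_boot all_order all_algebra.
From mathcomp Require Import all_classical all_reals all_analysis.
From mathcomp Require Import measurable_realfun zify ring lra.
Import Order.TTheory GRing.Theory Num.Theory numFieldNormedType.Exports.

(** With phi_j(s) = 1_{A_j}(s) - P_0(A_j), the kernel is the Gram kernel
    K(j,l) = \int phi_j phi_l dP_0, so that T = B^* B for (B f)(s) = \int phi_j(s) f(j) dnu(j).
    Hence <T f, f> = |B f|^2 >= 0, and for an orthonormal basis e, Parseval's identity for
    j |-> phi_j(s), integrated in s, gives \sum <T e_n, e_n> = \int\int phi_j(s)^2 = \int K(j,j).

    For the eigenvalue sum, let v_k be orthonormal eigenfunctions for the given eigenvalues.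
    By Bessel's inequality for the functions B v_k, the series \sum_k lam_k v_k(j) v_k(l)
    converges to a bounded kernel D.  If K - D were not the zero operator, this bounded
    symmetric kernel would have an eigenfunction for a nonzero eigenvalue: its even powers,
    rescaled by the growth rate of their traces, converge.  That eigenfunction would be an
    eigenfunction of K orthogonal to all the v_k, against the multiplicities.  Hence
    <T f, f> = \sum_k lam_k <f, v_k>^2, and summing over an orthonormal basis gives the trace.
    An orthonormal basis exists by the Gram-Schmidt process, since the sigma-algebra is
    countably generated and the v_k show that L^2 is infinite-dimensional. *)

Set Implicit Arguments.
Unset Strict Implicit.
Unset Printing Implicit Defensive.
Local Open Scope classical_set_scope.
Local Open Scope ring_scope.

(** * Integrals of real-valued functions *)

(** No spectral theorem, compactness argument or completeness of L^2 is invoked. All kernels are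
    bounded and measurable over probability spaces, so crude majorants suffice for Fubini and
    dominated convergence, and limits are only taken of numbers or of kernels at points. The price
    is that equations must hold at every point, whereas eigenfunctions are given almost everywhere;
    each e_k is therefore replaced by lam_k^-1 K e_k, which is bounded and solves the eigenvalue
    equation everywhere. Even powers enter because nothing is known about the sign of K - D: the
    trace of the (2n+2)-th power of a symmetric kernel is the squared Hilbert-Schmidt norm of its
    (n+1)-th power, and Cauchy-Schwarz makes these numbers log-convex and submultiplicative. As for
    the constants, K(j,j) = p_j - p_j^2 with p_j = P_0(A_j). This p_j is a product over the
    coordinates of factors t or 1 - t, and on [0,1] both have first moment 1/2 and second moment
    1/3. *)

Section real_integrals.
Context {d} {T : measurableType d} {R : realType}.
Implicit Types f g : T -> R.

Lemma le_integrableR (mu : {measure set T -> \bar R}) f g :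
  measurable_fun setT f -> (forall x, `|f x| <= g x) ->
  mu.-integrable setT (EFin \o g) -> mu.-integrable setT (EFin \o f).
Proof.
move=> mf fg; apply: le_integrable => //; first exact/measurable_EFinP.
by move=> x _ /=; rewrite lee_fin (le_trans (fg x))// ler_norm.
Qed.

Lemma integrableDR (mu : {measure set T -> \bar R}) f g :
  mu.-integrable setT (EFin \o f) -> mu.-integrable setT (EFin \o g) ->
  mu.-integrable setT (EFin \o (fun x => f x + g x)).
Proof. by move=> If Ig; apply: (integrableD _ If Ig). Qed.

Lemma integrableZR (mu : {measure set T -> \bar R}) (c : R) f :
  mu.-integrable setT (EFin \o f) ->
  mu.-integrable setT (EFin \o (fun x => c * f x)).
Proof. by move=> If; apply: (integrableZl _ _ If). Qed.

Lemma integrable_measurableR (mu : {measure set T -> \bar R}) f :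
  mu.-integrable setT (EFin \o f) -> measurable_fun setT f.
Proof. by move=> /integrableP[/measurable_EFinP]. Qed.

Lemma integrable_sumR (mu : {measure set T -> \bar R}) n (F : 'I_n -> T -> R) :
  (forall i, mu.-integrable setT (EFin \o F i)) ->
  mu.-integrable setT (EFin \o (fun x => \sum_(i < n) F i x)).
Proof.
move=> IF; rewrite (_ : _ \o _ = fun x => (\sum_(i < n) (F i x)%:E)%E).
  by apply: integrable_sum => // i _; exact: IF.
by apply/funext => x /=; rewrite sumEFin.
Qed.

Lemma Rintegral_sum (mu : {measure set T -> \bar R}) n (F : 'I_n -> T -> R) :
  (forall i, mu.-integrable setT (EFin \o F i)) ->
  \int[mu]_x (\sum_(i < n) F i x) = \sum_(i < n) \int[mu]_x F i x.
Proof.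
elim: n F => [|n IHn] F IF.
  under eq_Rintegral do rewrite big_ord0.
  by rewrite big_ord0 Rintegral_cst// mul0r.
under eq_Rintegral do rewrite big_ord_recr /=.
rewrite RintegralD//; first by rewrite IHn// big_ord_recr.
exact: integrable_sumR.
Qed.

Lemma ae_eq_Rintegral (mu : {measure set T -> \bar R}) f g :
  measurable_fun setT f -> measurable_fun setT g ->
  {ae mu, forall x, f x = g x} -> \int[mu]_x f x = \int[mu]_x g x.
Proof.
move=> mf mg fg; congr fine; apply: ae_eq_integral => //; try exact/measurable_EFinP.
by apply: filterS fg => x -> _.
Qed.

Lemma cvg_Rintegral (mu : {measure set T -> \bar R}) (F : nat -> T -> R) f g :
  (forall n, measurable_fun setT (F n)) -> measurable_fun setT f ->
  (forall x, F ^~ x @ \oo --> f x) -> mu.-integrable setT (EFin \o g) ->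
  (forall n x, `|F n x| <= g x) ->
  (fun n => \int[mu]_x F n x) @ \oo --> \int[mu]_x f x.
Proof.
move=> mF mf Ff Ig Fg.
have mF' n : measurable_fun setT (EFin \o F n) by exact/measurable_EFinP.
have mf' : measurable_fun setT (EFin \o f) by exact/measurable_EFinP.
have [] := dominated_convergence measurableT mF' mf' _ Ig.
- by apply: aeW => x _; apply: cvg_EFin (Ff x); exact: nearW.
- by apply: aeW => x n _; rewrite lee_fin.
move=> If _ H; apply: fine_cvg.
by rewrite fineK//; exact: integrable_fin_num.
Qed.

Lemma bounded_integrable (P : probability T R) f (C : R) :
  measurable_fun setT f -> (forall x, `|f x| <= C) ->
  P.-integrable setT (EFin \o f).
Proof.
move=> mf fC; apply: (@le_integrableR _ _ (cst C)) => //.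
exact: finite_measure_integrable_cst.
Qed.

Lemma Rintegral_bound (P : probability T R) f (C : R) :
  measurable_fun setT f -> (forall x, `|f x| <= C) -> `|\int[P]_x f x| <= C.
Proof.
move=> mf fC; have If := bounded_integrable P mf fC.
apply: le_trans (le_normr_Rintegral measurableT If) _.
rewrite -[leRHS]mulr1 -[1]/(fine 1%E) -(@probability_setT _ _ _ P) -Rintegral_cst//.
apply: le_Rintegral => //; last exact: finite_measure_integrable_cst.
apply: (@bounded_integrable _ _ C) => [|x]; first exact: measurableT_comp.
by rewrite normr_id.
Qed.

End real_integrals.

(** * Fubini's theorem under domination in the first variable *)

Section iterated_integrals.
Context {d1 d2} {X : measurableType d1} {Y : measurableType d2} {R : realType}.
Variables (mu : probability X R) (nu : probability Y R) (F : X * Y -> R).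
Hypothesis mF : measurable_fun setT F.

Lemma measurable_xsection_fun x : measurable_fun setT (fun y => F (x, y)).
Proof. exact: measurableT_comp. Qed.

Lemma measurable_ysection_fun y : measurable_fun setT (fun x => F (x, y)).
Proof. exact: measurableT_comp. Qed.

Variable g : X -> R.
Hypotheses (Ig : mu.-integrable setT (EFin \o g))
  (Fg : forall x y, `|F (x, y)| <= g x).

Let IF2 x : nu.-integrable setT (EFin \o (fun y => F (x, y))).
Proof. exact: (bounded_integrable _ (measurable_xsection_fun x)). Qed.

Let IF1 y : mu.-integrable setT (EFin \o (fun x => F (x, y))).
Proof. exact: (le_integrableR (measurable_ysection_fun y)). Qed.

(** Since [nu] has total mass 1, integrating the bound over y leaves it unchanged, and the double
    integral of |F| is at most that of |g|. *)
Lemma dominated_integrable_prod : (mu \x nu)%E.-integrable setT (EFin \o F).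
Proof.
apply/integrable12ltyP; first exact/measurable_EFinP.
have /integrableP[_] := Ig; apply: le_lt_trans; apply: ge0_le_integral => //.
- by move=> x _; apply: integral_ge0.
- apply: (measurable_fun_fubini_tonelli_F (abse \o EFin \o F)) => //=.
  by apply: measurableT_comp => //; apply/measurable_EFinP.
- by apply: measurableT_comp => //; exact: (measurable_int _ Ig).
move=> x _ /=; apply: (@le_trans _ _ (\int[nu]_y (`|g x|)%:E)%E).
  apply: ge0_le_integral => //.
  + by do 2 apply: measurableT_comp => //; exact: measurable_xsection_fun.
  + by move=> y _; rewrite lee_fin (le_trans (Fg x y))// ler_norm.
by rewrite integral_cst//= probability_setT mule1.
Qed.

Let RF x : (\int[nu]_y F (x, y))%:E = (\int[nu]_y (F (x, y))%:E)%E.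
Proof. by rewrite fineK//; exact: integrable_fin_num (IF2 x). Qed.

Let RG y : (\int[mu]_x F (x, y))%:E = (\int[mu]_x (F (x, y))%:E)%E.
Proof. by rewrite fineK//; exact: integrable_fin_num (IF1 y). Qed.

Lemma measurable_Rintegral2 : measurable_fun setT (fun x => \int[nu]_y F (x, y)).
Proof.
apply/measurable_EFinP; rewrite (_ : _ \o _ = fubini_F nu (EFin \o F)).
  exact: (measurable_fubini_F dominated_integrable_prod).
by apply/funext => x; exact: RF.
Qed.

Lemma measurable_Rintegral1 : measurable_fun setT (fun y => \int[mu]_x F (x, y)).
Proof.
apply/measurable_EFinP; rewrite (_ : _ \o _ = fubini_G mu (EFin \o F)).
  exact: (measurable_fubini_G dominated_integrable_prod).
by apply/funext => x; exact: RG.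
Qed.

Lemma Rintegral12_prod :
  \int[(mu \x nu)%E]_z F z = \int[mu]_x \int[nu]_y F (x, y).
Proof.
congr fine; rewrite -(integral12_prod_meas1 dominated_integrable_prod).
by apply: eq_integral => x _; rewrite RF.
Qed.

Lemma Rintegral_swap :
  \int[mu]_x \int[nu]_y F (x, y) = \int[nu]_y \int[mu]_x F (x, y).
Proof.
rewrite -Rintegral12_prod; congr fine.
rewrite -(integral21_prod_meas1 dominated_integrable_prod).
by apply: eq_integral => x _; rewrite RG.
Qed.

End iterated_integrals.
Arguments measurable_Rintegral2 {d1 d2 X Y R} mu nu F mF g.
Arguments measurable_Rintegral1 {d1 d2 X Y R} mu nu F mF g.
Arguments Rintegral12_prod {d1 d2 X Y R} mu nu F mF g.
Arguments Rintegral_swap {d1 d2 X Y R} mu nu F mF g.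

(** * The semi-inner product of L^2 *)

Section L2.
Context {d} {T : measurableType d} {R : realType}.
Variable mu : {measure set T -> \bar R}.
Implicit Types f g h : T -> R.
Local Notation L2 := (Lfun mu 2%:E).
Local Notation dot := (L2dot mu).

(** Integrability is assumed because [dot] takes the finite part of the integral, which would turn
    an infinite norm into 0. *)
Lemma Lnorm2E f : measurable_fun setT f ->
  mu.-integrable setT (EFin \o (fun x => f x ^+ 2)) ->
  ('N[mu]_2%:E[EFin \o f] = (Num.sqrt (dot f f))%:E)%E.
Proof.
move=> mf If; rewrite unlock /Lnorm.
have -> : (\int[mu]_x `|(EFin \o f) x| `^ 2 = (dot f f)%:E)%E.
  rewrite /L2dot fineK; last by apply: integrable_fin_num => //.
  by apply: eq_integral => x _ /=; rewrite powR_mulrn// real_normK ?num_real// expr2.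
by rewrite poweR_EFin powR12_sqrt// Rintegral_ge0// => x _; rewrite -expr2 sqr_ge0.
Qed.

Lemma Lfun2P f : f \in L2 <-> measurable_fun setT f /\
  mu.-integrable setT (EFin \o (fun x => f x ^+ 2)).
Proof.
split=> [fL|[mf If]].
  split; last exact: Lfun2_integrable_sqr.
  by move: fL => /andP[/[!inE]].
by apply/andP; split; rewrite inE//= /finite_norm Lnorm2E// ltry.
Qed.

Lemma Lfun2_measurable f : f \in L2 -> measurable_fun setT f.
Proof. by case/Lfun2P. Qed.

Lemma Lfun2_mul_integrable f g : f \in L2 -> g \in L2 ->
  mu.-integrable setT (EFin \o (fun x => f x * g x)).
Proof. by move=> fL gL; apply/Lfun1_integrable; exact: Lfun2_mul_Lfun1. Qed.

Lemma Lfun2D f g : f \in L2 -> g \in L2 -> (fun x => f x + g x) \in L2.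
Proof.
move=> fL gL; apply/Lfun2P; split.
  by apply: measurable_funD; exact: Lfun2_measurable.
rewrite (_ : _ \o _ = EFin \o (fun x => f x ^+ 2 + (2 * (f x * g x) + g x ^+ 2))).
  apply: integrableDR; first exact: Lfun2_integrable_sqr.
  apply: integrableDR; last exact: Lfun2_integrable_sqr.
  by apply: integrableZR; exact: Lfun2_mul_integrable.
by apply/funext => x /=; congr EFin; ring.
Qed.

Lemma Lfun2Z (c : R) f : f \in L2 -> (fun x => c * f x) \in L2.
Proof.
move=> fL; apply/Lfun2P; split.
  by apply: measurable_funM => //; exact: Lfun2_measurable.
rewrite (_ : _ \o _ = EFin \o (fun x => c ^+ 2 * f x ^+ 2)).
  by apply: integrableZR; exact: Lfun2_integrable_sqr.
by apply/funext => x /=; congr EFin; ring.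
Qed.

Lemma Lfun2B f g : f \in L2 -> g \in L2 -> (fun x => f x - g x) \in L2.
Proof.
move=> fL gL; rewrite (_ : (fun _ => _) = fun x => f x + (-1) * g x).
  by apply: Lfun2D => //; exact: Lfun2Z.
by apply/funext => x; rewrite mulN1r.
Qed.

Lemma Lfun2_sum n (F : 'I_n -> T -> R) : (forall i, F i \in L2) ->
  (fun x => \sum_(i < n) F i x) \in L2.
Proof.
elim: n F => [|n IHn] F FL.
  rewrite (_ : (fun _ => _) = cst 0); last first.
    by apply/funext => x; rewrite big_ord0.
  apply/Lfun2P; split => //.
  rewrite (_ : _ \o _ = cst 0%E); first exact: integrable0.
  by apply/funext => x /=; rewrite expr0n.
rewrite (_ : (fun _ => _) =
    fun x => (\sum_(i < n) F (widen_ord (leqnSn n) i) x) + F ord_max x).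
  by apply: Lfun2D => //; exact: IHn.
by apply/funext => x; rewrite big_ord_recr.
Qed.

Lemma Lfun2_lin n (c : 'I_n -> R) (u : 'I_n -> T -> R) : (forall i, u i \in L2) ->
  (fun x => \sum_(i < n) c i * u i x) \in L2.
Proof. by move=> uL; apply: Lfun2_sum => i; exact: Lfun2Z. Qed.

Lemma L2dotC f g : dot f g = dot g f.
Proof. by apply: eq_Rintegral => x _; rewrite mulrC. Qed.

Lemma L2dotDl f g h : f \in L2 -> g \in L2 -> h \in L2 ->
  dot (fun x => f x + g x) h = dot f h + dot g h.
Proof.
move=> fL gL hL; rewrite /L2dot -RintegralD//; try exact: Lfun2_mul_integrable.
by apply: eq_Rintegral => x _; rewrite mulrDl.
Qed.

Lemma L2dotZl c f h : f \in L2 -> h \in L2 ->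
  dot (fun x => c * f x) h = c * dot f h.
Proof.
move=> fL hL; rewrite /L2dot -RintegralZl//; try exact: Lfun2_mul_integrable.
by apply: eq_Rintegral => x _; rewrite mulrA.
Qed.

Lemma L2dotBl f g h : f \in L2 -> g \in L2 -> h \in L2 ->
  dot (fun x => f x - g x) h = dot f h - dot g h.
Proof.
move=> fL gL hL; rewrite /L2dot -RintegralB//; try exact: Lfun2_mul_integrable.
by apply: eq_Rintegral => x _; rewrite mulrBl.
Qed.

Lemma L2dotBr f g h : f \in L2 -> g \in L2 -> h \in L2 ->
  dot h (fun x => f x - g x) = dot h f - dot h g.
Proof. by move=> *; rewrite ![dot h _]L2dotC L2dotBl. Qed.

Lemma L2dotZr c f h : f \in L2 -> h \in L2 ->
  dot h (fun x => c * f x) = c * dot h f.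
Proof. by move=> *; rewrite ![dot h _]L2dotC L2dotZl. Qed.

Lemma L2dot_suml n (c : 'I_n -> R) (u : 'I_n -> T -> R) h :
  (forall i, u i \in L2) -> h \in L2 ->
  dot (fun x => \sum_(i < n) c i * u i x) h = \sum_(i < n) c i * dot (u i) h.
Proof.
move=> uL hL; rewrite /L2dot.
under eq_Rintegral do rewrite mulr_suml.
rewrite Rintegral_sum => [|i]; last first.
  by apply: (Lfun2_mul_integrable (f := fun x => c i * u i x)) => //; exact: Lfun2Z.
by apply: eq_bigr => i _; rewrite -L2dotZl.
Qed.

Lemma L2dot_ge0 f : 0 <= dot f f.
Proof. by apply: Rintegral_ge0 => x _; rewrite -expr2 sqr_ge0. Qed.

Lemma L2dot_subsub f g : f \in L2 -> g \in L2 ->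
  dot (fun x => f x - g x) (fun x => f x - g x) = dot f f - 2 * dot f g + dot g g.
Proof.
move=> fL gL; have fgL := Lfun2B fL gL.
by rewrite L2dotBl// !L2dotBr// [dot g f]L2dotC; ring.
Qed.

(** The polynomial t |-> |f - t g|^2 is nonnegative. It is evaluated at its minimum b / c when c >
    0. *)
Lemma CauchySchwarz f g : f \in L2 -> g \in L2 ->
  dot f g ^+ 2 <= dot f f * dot g g.
Proof.
move=> fL gL; set a := dot f f; set b := dot f g; set c := dot g g.
have H t : 0 <= a - 2 * t * b + t ^+ 2 * c.
  have := L2dot_ge0 (fun x => f x - t * g x).
  rewrite L2dot_subsub//; last exact: Lfun2Z.
  have tgL := Lfun2Z t gL.
  rewrite L2dotZr// L2dotZl// L2dotZr//.
  by rewrite -/a -/b -/c; congr (0 <= _); ring.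
have [c0|c0] := eqVneq c 0.
  rewrite c0 mulr0; have [->|b0] := eqVneq b 0; first by rewrite expr0n.
  (* With c = 0 the polynomial is affine in t of slope -2 b, and this t makes it equal to -1. *)
  have := H ((a + 1) / (2 * b)); rewrite c0.
  have -> : a - 2 * ((a + 1) / (2 * b)) * b + ((a + 1) / (2 * b)) ^+ 2 * 0 = -1.
    by field.
  by rewrite leNgt oppr_lt0 ltr01.
have cp : 0 < c by rewrite lt_def c0 L2dot_ge0.
have := H (b / c).
have -> : a - 2 * (b / c) * b + (b / c) ^+ 2 * c = (a * c - b ^+ 2) / c by field.
by rewrite pmulr_lge0 ?invr_gt0// subr_ge0.
Qed.

Lemma L2dot_eq0 f : f \in L2 -> dot f f = 0 -> {ae mu, forall x, f x = 0}.
Proof.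
move=> /Lfun2P[mf If] f0.
have : (\int[mu]_x `|(EFin \o (fun x => f x ^+ 2)%R) x| = 0)%E.
  rewrite -[RHS]/(0%:E) -f0 /L2dot fineK; last exact: integrable_fin_num.
  by apply: eq_integral => x _ /=; rewrite ger0_norm ?sqr_ge0// expr2.
move/(ae_eq_integral_abs _ measurableT (measurable_int _ If)).
by apply: filterS => x /(_ I) /= [] /eqP; rewrite sqrf_eq0 => /eqP.
Qed.

Lemma ae0_L2dot f g : f \in L2 -> g \in L2 ->
  {ae mu, forall x, f x = 0} -> dot f g = 0.
Proof.
move=> fL gL f0; rewrite /L2dot (ae_eq_Rintegral (g := cst 0)).
- by rewrite Rintegral_cst// mul0r.
- by apply: measurable_funM; exact: Lfun2_measurable.
- exact: measurable_cst.
- by apply: filterS f0 => x ->; rewrite mul0r.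
Qed.

Lemma ae_eq_L2dot f f' g g' : f \in L2 -> f' \in L2 -> g \in L2 -> g' \in L2 ->
  {ae mu, forall x, f x = f' x} -> {ae mu, forall x, g x = g' x} ->
  dot f g = dot f' g'.
Proof.
move=> fL f'L gL g'L ff' gg'; apply: ae_eq_Rintegral.
- by apply: measurable_funM; exact: Lfun2_measurable.
- by apply: measurable_funM; exact: Lfun2_measurable.
by apply: filterS2 ff' gg' => x -> ->.
Qed.

(** A sequence on [nat] of which only the first n terms matter, rather than a family on ['I_n]:
    Gram-Schmidt can then extend it without changing types. *)
Definition orthonormal n (u : nat -> T -> R) :=
  (forall i, (i < n)%N -> u i \in L2) /\
  forall i j, (i < n)%N -> (j < n)%N -> dot (u i) (u j) = (i == j)%:R.

Definition projn n (u : nat -> T -> R) f x := \sum_(k < n) dot f (u k) * u k x.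

Lemma Lfun2_projn n u f : orthonormal n u -> projn n u f \in L2.
Proof. by move=> [uL _]; apply: Lfun2_lin => i; exact: uL. Qed.

Lemma L2dot_projn n u f j : orthonormal n u -> (j < n)%N ->
  dot (projn n u f) (u j) = dot f (u j).
Proof.
move=> [uL uo] jn; rewrite L2dot_suml//; [|by move=> i; exact: uL|exact: uL].
rewrite (bigD1 (Ordinal jn))//= uo// eqxx mulr1 big1 ?addr0// => i.
by rewrite -val_eqE /= uo// => /negbTE ->; rewrite mulr0.
Qed.

Lemma L2dot_projn_lin n u f (c : 'I_n -> R) : orthonormal n u -> f \in L2 ->
  dot f (fun x => \sum_(k < n) c k * u k x) = \sum_(k < n) c k * dot f (u k).
Proof.
move=> [uL _] fL; rewrite L2dotC L2dot_suml//; last by move=> i; exact: uL.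
by apply: eq_bigr => i _; rewrite L2dotC.
Qed.

Lemma L2dot_lin n u (c : 'I_n -> R) : orthonormal n u ->
  dot (fun x => \sum_(k < n) c k * u k x) (fun x => \sum_(k < n) c k * u k x) =
  \sum_(k < n) c k ^+ 2.
Proof.
move=> uo; have [uL uo'] := uo.
rewrite L2dot_projn_lin//; last by apply: Lfun2_lin => i; exact: uL.
apply: eq_bigr => i _; rewrite L2dot_suml//; try by move=> *; exact: uL.
rewrite (bigD1 i)//= uo'// eqxx mulr1 big1 ?addr0 ?expr2// => j.
by rewrite -val_eqE /= uo'// => /negbTE ->; rewrite mulr0.
Qed.

Lemma dist_projn n u f : orthonormal n u -> f \in L2 ->
  dot (fun x => f x - projn n u f x) (fun x => f x - projn n u f x) =
  dot f f - \sum_(k < n) dot f (u k) ^+ 2.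
Proof.
move=> uo fL; rewrite L2dot_subsub//; last exact: Lfun2_projn.
rewrite /projn L2dot_lin// L2dot_projn_lin//.
by under eq_bigr do rewrite -expr2; ring.
Qed.

Lemma Bessel n u f : orthonormal n u -> f \in L2 ->
  \sum_(k < n) dot f (u k) ^+ 2 <= dot f f.
Proof. by move=> uo fL; rewrite -subr_ge0 -dist_projn// L2dot_ge0. Qed.

(** The right side exceeds the left by the sum of the squares (c_k - <f, u_k>)^2. *)
Lemma dist_projn_min n u f (c : 'I_n -> R) : orthonormal n u -> f \in L2 ->
  dot (fun x => f x - projn n u f x) (fun x => f x - projn n u f x) <=
  dot (fun x => f x - \sum_(k < n) c k * u k x)
      (fun x => f x - \sum_(k < n) c k * u k x).
Proof.
move=> uo fL; have [uL _] := uo; rewrite dist_projn// L2dot_subsub//; last first.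
  by apply: Lfun2_lin => i; exact: uL.
rewrite L2dot_lin// L2dot_projn_lin// -subr_ge0.
rewrite [X in 0 <= X](_ : _ = \sum_(k < n) (c k - dot f (u k)) ^+ 2).
  by apply: sumr_ge0 => i _; exact: sqr_ge0.
have -> : \sum_(k < n) (c k - dot f (u k)) ^+ 2 = \sum_(k < n) c k ^+ 2 -
    2 * (\sum_(k < n) c k * dot f (u k)) + \sum_(k < n) dot f (u k) ^+ 2.
  by rewrite mulr_sumr -sumrB -big_split; apply: eq_bigr => k _ /=; ring.
ring.
Qed.

End L2.

Lemma bounded_Lfun2 {d} {T : measurableType d} {R : realType}
    (P : probability T R) (f : T -> R) (C : R) :
  measurable_fun setT f -> (forall x, `|f x| <= C) -> f \in Lfun P 2%:E.
Proof.
move=> mf fC; apply/Lfun2P; split => //.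
apply: (bounded_integrable P (C := C ^+ 2)); first exact: measurable_funX.
by move=> x; rewrite normrX lerXn2r// nnegrE ?(le_trans _ (fC x)).
Qed.

Lemma Lfun2_integrable {d} {T : measurableType d} {R : realType}
    (P : probability T R) (f : T -> R) :
  f \in Lfun P 2%:E -> P.-integrable setT (EFin \o f).
Proof.
by move=> fL; apply/Lfun1_integrable; apply: Lfun_subset12 => //; exact: fin_num_measure.
Qed.

(** * Operators with bounded kernels *)

Section bounded_kernels.
Context {dX dY} {X : measurableType dX} {Y : measurableType dY} {R : realType}.

(** Joint measurability and a bound valid at every point; this class is stable under transposition,
    composition and bounded pointwise limits, and its rows, columns and diagonal are integrable for
    any probability. *)
Definition bounded_kernel (F : X -> Y -> R) :=
  measurable_fun setT (fun z : X * Y => F z.1 z.2) /\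
  exists C, forall x y, `|F x y| <= C.

(* [integral_operator] for a kernel between two different spaces *)
Definition kop (nu : {measure set Y -> \bar R}) (F : X -> Y -> R) (g : Y -> R) (x : X) : R :=
  \int[nu]_y (F x y * g y).

Lemma bounded_kernel_meas_comp d (W : measurableType d) (F : X -> Y -> R)
    (f : W -> X) (g : W -> Y) : bounded_kernel F ->
  measurable_fun setT f -> measurable_fun setT g ->
  measurable_fun setT (fun w => F (f w) (g w)).
Proof.
by move=> [mF _] mf mg; exact: (measurableT_comp mF (measurable_fun_pair mf mg)).
Qed.

Lemma bounded_kernel_row F x : bounded_kernel F -> measurable_fun setT (F x).
Proof. by move=> bF; apply: (bounded_kernel_meas_comp bF). Qed.

Lemma bounded_kernel_col F y : bounded_kernel F -> measurable_fun setT (F ^~ y).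
Proof. by move=> bF; apply: (bounded_kernel_meas_comp bF). Qed.

Lemma bounded_kernel_bound F : bounded_kernel F ->
  exists2 C : R, 0 <= C & forall x y, `|F x y| <= C.
Proof.
move=> [_ [C FC]]; exists `|C| => // x y.
exact: le_trans (FC x y) (ler_norm _).
Qed.

End bounded_kernels.

Lemma bounded_kernel_tr {dX dY} {X : measurableType dX} {Y : measurableType dY}
  {R : realType} (F : X -> Y -> R) : bounded_kernel F -> bounded_kernel (fun y x => F x y).
Proof.
move=> bF; split; first exact: (bounded_kernel_meas_comp bF).
by have [_ [C FC]] := bF; exists C.
Qed.

Section kernel_operators.
Context {dX dY} {X : measurableType dX} {Y : measurableType dY} {R : realType}.
Variables (mu : probability X R) (nu : probability Y R).
Implicit Types (F : X -> Y -> R) (g : Y -> R).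

Lemma kop_integrable F g x : bounded_kernel F -> nu.-integrable setT (EFin \o g) ->
  nu.-integrable setT (EFin \o (fun y => F x y * g y)).
Proof.
move=> bF Ig; have [C C0 FC] := bounded_kernel_bound bF.
apply: (le_integrableR (g := fun y => C * `|g y|)).
- apply: measurable_funM; first exact: bounded_kernel_row.
  exact: integrable_measurableR Ig.
- by move=> y; rewrite normrM ler_wpM2r.
by apply: integrableZR; exact: integrable_norm.
Qed.

Lemma measurable_kop F g : bounded_kernel F -> nu.-integrable setT (EFin \o g) ->
  measurable_fun setT (kop nu F g).
Proof.
move=> bF Ig; have [C C0 FC] := bounded_kernel_bound bF.
have mg := integrable_measurableR Ig.
apply: (measurable_Rintegral1 nu mu (fun z => F z.2 z.1 * g z.1) _
    (fun y => C * `|g y|)).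
- apply: measurable_funM; last exact: measurableT_comp.
  exact: (bounded_kernel_meas_comp bF).
- by apply: integrableZR; exact: integrable_norm.
by move=> y x /=; rewrite normrM ler_wpM2r.
Qed.

Lemma kop_bound F g (C : R) x : bounded_kernel F -> nu.-integrable setT (EFin \o g) ->
  (forall x y, `|F x y| <= C) -> `|kop nu F g x| <= C * \int[nu]_y `|g y|.
Proof.
move=> bF Ig FC; have IFg := kop_integrable x bF Ig.
apply: (le_trans (le_normr_Rintegral _ IFg)) => //.
rewrite -RintegralZl//; last exact: integrable_norm.
apply: le_Rintegral => //; first exact: integrable_norm IFg.
  by apply: integrableZR; exact: integrable_norm.
by move=> y _; rewrite normrM ler_wpM2r.
Qed.

Lemma kop_Lfun2 F g : bounded_kernel F -> nu.-integrable setT (EFin \o g) ->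
  kop nu F g \in Lfun mu 2%:E.
Proof.
move=> bF Ig; have [C _ FC] := bounded_kernel_bound bF.
apply: bounded_Lfun2 (measurable_kop bF Ig) _ => x.
exact: kop_bound FC.
Qed.

Lemma kop_integrable1 F g : bounded_kernel F -> nu.-integrable setT (EFin \o g) ->
  mu.-integrable setT (EFin \o kop nu F g).
Proof. by move=> bF Ig; apply: Lfun2_integrable; exact: kop_Lfun2. Qed.

End kernel_operators.

Section kernel_adjoint.
Context {dX dY} {X : measurableType dX} {Y : measurableType dY} {R : realType}.
Variables (mu : probability X R) (nu : probability Y R).

(** Fubini. The bound on [g] yields the majorant CF * C * |f x|, which depends on x alone as the
    exchange of integrals demands. *)
Lemma kop_adjoint (F : X -> Y -> R) (g : Y -> R) (f : X -> R) (C : R) : bounded_kernel F ->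
  measurable_fun setT g -> (forall y, `|g y| <= C) -> mu.-integrable setT (EFin \o f) ->
  L2dot mu (kop nu F g) f = L2dot nu g (kop mu (fun y x => F x y) f).
Proof.
move=> bF mg gC If; have Ig := bounded_integrable nu mg gC.
have [CF CF0 FCF] := bounded_kernel_bound bF; have mf := integrable_measurableR If.
transitivity (\int[mu]_x \int[nu]_y (F x y * g y * f x)).
  by apply: eq_Rintegral => x _; rewrite -RintegralZr//; exact: kop_integrable.
rewrite (Rintegral_swap mu nu (fun z => F z.1 z.2 * g z.2 * f z.1) _
    (fun x => CF * C * `|f x|)); last first.
- by move=> x y /=; rewrite !normrM ler_wpM2r// ler_pM.
- by apply: integrableZR; exact: integrable_norm.
- apply: measurable_funM; last exact: measurableT_comp.
  by apply: measurable_funM; [exact: (bounded_kernel_meas_comp bF)|exact: measurableT_comp].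
apply: eq_Rintegral => y _ /=.
under eq_Rintegral do rewrite mulrAC mulrC.
rewrite RintegralZl//.
exact: (kop_integrable y (bounded_kernel_tr bF) If).
Qed.

End kernel_adjoint.

Section kernel_composition.
Context {dX dY dZ} {X : measurableType dX} {Y : measurableType dY}
  {Z : measurableType dZ} {R : realType}.
Variables (mu : probability X R) (nu : probability Y R) (rho : probability Z R).
Implicit Types (F : X -> Y -> R) (G : Y -> Z -> R).

Definition kcomp (nu : {measure set Y -> \bar R}) F G x z : R :=
  \int[nu]_y (F x y * G y z).

Lemma bounded_kernel_comp F G : bounded_kernel F -> bounded_kernel G ->
  bounded_kernel (kcomp nu F G).
Proof.
move=> bF bG; have [CF CF0 FC] := bounded_kernel_bound bF.
have [CG CG0 GC] := bounded_kernel_bound bG.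
have FG x y z : `|F x y * G y z| <= CF * CG by rewrite normrM ler_pM.
split.
  apply: (measurable_Rintegral2 (mu \x rho)%E nu
    (fun w => F w.1.1 w.2 * G w.2 w.1.2) _ (cst (CF * CG))).
  - apply: measurable_funM; [apply: (bounded_kernel_meas_comp bF)|
      apply: (bounded_kernel_meas_comp bG)] => //; exact: measurableT_comp.
  - exact: finite_measure_integrable_cst.
  - by move=> x y; exact: FG.
exists (CF * CG) => x z; apply: Rintegral_bound => // .
by apply: measurable_funM; [exact: bounded_kernel_row|exact: bounded_kernel_col].
Qed.

(** Fubini at a fixed x, hence an identity at every point and not only almost everywhere. *)
Lemma kop_comp F G h x : bounded_kernel F -> bounded_kernel G ->
  rho.-integrable setT (EFin \o h) ->
  kop rho (kcomp nu F G) h x = kop nu F (kop rho G h) x.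
Proof.
move=> bF bG Ih; have [CF CF0 FC] := bounded_kernel_bound bF.
have [CG CG0 GC] := bounded_kernel_bound bG; have mh := integrable_measurableR Ih.
transitivity (\int[rho]_z \int[nu]_y (F x y * G y z * h z)).
  apply: eq_Rintegral => z _; rewrite -RintegralZr//.
  apply: (bounded_integrable nu (C := CF * CG)) => [|y].
    by apply: measurable_funM; [exact: bounded_kernel_row|exact: bounded_kernel_col].
  by rewrite normrM ler_pM.
rewrite (Rintegral_swap rho nu
    (fun w => F x w.2 * G w.2 w.1 * h w.1) _ (fun z => CF * CG * `|h z|)).
- apply: eq_Rintegral => y _ /=; rewrite -RintegralZl//; last exact: kop_integrable.
  by apply: eq_Rintegral => z _; rewrite mulrA.
- apply: measurable_funM; last exact: measurableT_comp.
  by apply: measurable_funM;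
   [exact: (bounded_kernel_meas_comp bF)|exact: (bounded_kernel_meas_comp bG)].
- by apply: integrableZR; exact: integrable_norm.
- by move=> z y /=; rewrite !normrM ler_wpM2r// ler_pM.
Qed.

End kernel_composition.

(** * Existence of an eigenfunction *)

Section growth_rate.
Context {R : realType}.
Variable b : nat -> R.
Hypotheses (b0 : 0 < b 0%N) (b1 : 0 < b 1%N)
  (b_convex : forall n, b n.+1 ^+ 2 <= b n * b n.+2)
  (b_submul : forall n m, b (n + m).+1 <= b n * b m).

Let b_gt0 n : 0 < b n.
Proof.
suff: 0 < b n /\ 0 < b n.+1 by case.
elim: n => [|n [bn bn1]]; split => //.
by rewrite -(pmulr_rgt0 _ bn); apply: lt_le_trans (b_convex n); rewrite exprn_gt0.
Qed.

Let r n := b n.+1 / b n.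

Let r_nd n m : r n <= r (n + m).
Proof.
elim: m => [|m IHm]; first by rewrite addn0.
apply: (le_trans IHm); rewrite addnS /r ler_pdivrMr// mulrAC ler_pdivlMr//.
by rewrite -expr2 mulrC.
Qed.

Let r_exp n j : r n ^+ j * b n <= b (n + j).
Proof.
elim: j => [|j IHj]; first by rewrite expr0 mul1r addn0.
rewrite exprS -mulrA addnS -[b _.+1](divfK (lt0r_neq0 (b_gt0 (n + j)))).
have r0 : 0 <= r n by rewrite divr_ge0// ltW.
apply: ler_pM => //; last exact: r_nd.
by rewrite mulr_ge0 ?exprn_ge0// ltW.
Qed.

(* [r n ^+ m.+1 * b n <= b (n + m).+1 <= b n * b m] *)
Let r_le n m : r n ^+ m.+1 <= b m.
Proof. by rewrite -(ler_pM2r (b_gt0 n)) (le_trans (r_exp _ _))// addnS mulrC. Qed.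

(** L is the supremum of the ratios r n = b (n+1) / b n. Log-convexity makes r nondecreasing, so r n
    ^ (m+1) * b n <= b (n + m + 1) <= b n * b m; cancelling b n bounds every ratio by the (m+1)-th
    root of b m. For b n = tr K^(2n+2), L plays the part of the largest squared eigenvalue. *)
Lemma growth_rate : exists L : R, [/\ 0 < L, forall n, b n.+1 <= L * b n &
  forall n, L ^+ n.+1 <= b n].
Proof.
have rb m n : r n <= b m `^ (m.+1%:R^-1).
  have r0 : 0 <= r n by rewrite divr_ge0// ltW.
  rewrite -[leLHS](powRr1 r0) -[X in r n `^ X](@mulfV _ m.+1%:R) ?pnatr_eq0//.
  by rewrite powRrM powR_mulrn// ge0_ler_powR ?invr_ge0 ?nnegrE ?exprn_ge0// ltW.
have hr : has_sup (range r).
  split; first by exists (r 0%N), 0%N.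
  by exists (b 0%N `^ (1%:R^-1)) => _ [n _ <-].
have rL n : r n <= sup (range r) by apply: ub_le_sup; [case: hr|exists n].
have L0 : 0 < sup (range r) by exact: lt_le_trans (divr_gt0 b1 b0) (rL 0%N).
exists (sup (range r)); split => // n; first by rewrite -ler_pdivrMr//; exact: rL.
have : sup (range r) <= b n `^ (n.+1%:R^-1).
  by apply: ge_sup => [|_ [m _ <-]//]; case: hr.
move=> /(@lerXn2r _ n.+1); rewrite !nnegrE powR_ge0 ltW// => /(_ isT isT) /le_trans; apply.
by rewrite -powR_mulrn ?powR_ge0// -powRrM mulVf ?pnatr_eq0// powRr1// ltW.
Qed.

End growth_rate.

Lemma cvg_sqr_dist {R : realType} (u delta : nat -> R) :
  delta @ \oo --> 0 ->
  (forall n m, (n <= m)%N -> (u n - u m) ^+ 2 <= delta n) -> cvgn u.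
Proof.
move=> d0 ud; apply/cauchy_cvgP/cauchy_exP => e e0.
have e20 : 0 < e ^+ 2 by rewrite exprn_gt0.
have [N _ Nd] : \forall n \near \oo, delta n < e ^+ 2.
  exact: (cvgr_lt _ d0 _ e20).
exists (u N); change (\forall m \near \oo, `|u N - u m| < e); near=> m.
have : `|u N - u m| ^+ 2 < e ^+ 2.
  rewrite real_normK ?num_real//; apply: le_lt_trans (ud N m _) (Nd N _) => //=.
  by near: m; exact: nbhs_infty_ge.
by rewrite ltr_pXn2r// ?nnegrE// ltW.
Unshelve. all: by end_near. Qed.

(** * The Hilbert-Schmidt product of kernels *)

Section hilbert_schmidt.
Context {d} {X : measurableType d} {R : realType}.
Variable mu : probability X R.
Local Notation comp := (kcomp mu).
Local Notation mu2 := (mu \x mu)%E.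

Definition uncurryk (F : X -> X -> R) (z : X * X) := F z.1 z.2.
Definition hsdot (F G : X -> X -> R) := L2dot mu2 (uncurryk F) (uncurryk G).

Lemma kcompA (F G H : X -> X -> R) :
  bounded_kernel F -> bounded_kernel G -> bounded_kernel H ->
  comp (comp F G) H = comp F (comp G H).
Proof.
move=> bF bG bH; apply/funext => x; apply/funext => y.
apply: (kop_comp mu (h := H ^~ y)) => //; have [_ [C HC]] := bH.
by apply: (bounded_integrable mu (C := C)) => //; exact: bounded_kernel_col.
Qed.

Lemma hs_Lfun2 (F : X -> X -> R) : bounded_kernel F -> uncurryk F \in Lfun mu2 2%:E.
Proof. by move=> [mF [C FC]]; apply: (bounded_Lfun2 _ (C := C)) => // -[]. Qed.

Lemma hsdotE (F G : X -> X -> R) : bounded_kernel F -> bounded_kernel G ->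
  hsdot F G = \int[mu]_x \int[mu]_y (F x y * G x y).
Proof.
move=> bF bG; have [CF CF0 FC] := bounded_kernel_bound bF.
have [CG CG0 GC] := bounded_kernel_bound bG.
rewrite /hsdot /L2dot (Rintegral12_prod _ _ _ _ (cst (CF * CG)))//.
- exact: measurable_funM (proj1 bF) (proj1 bG).
- exact: finite_measure_integrable_cst.
by move=> x y; rewrite /uncurryk/= normrM ler_pM.
Qed.

(** Cauchy-Schwarz at each (x, y) bounds the squared composite by A x * B y, with A and B the
    squared norms of the rows of F and the columns of G; the double integral of this product
    factors. *)
Lemma hs_comp (F G : X -> X -> R) : bounded_kernel F -> bounded_kernel G ->
  hsdot (comp F G) (comp F G) <= hsdot F F * hsdot G G.
Proof.
move=> bF bG; have bFG := bounded_kernel_comp mu mu mu bF bG.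
have [CF CF0 FC] := bounded_kernel_bound bF.
have [CG CG0 GC] := bounded_kernel_bound bG.
have rowL x : F x \in Lfun mu 2%:E.
  by apply: bounded_Lfun2 (FC x); exact: bounded_kernel_row.
have colL y : G ^~ y \in Lfun mu 2%:E.
  by apply: bounded_Lfun2 (GC ^~ y); exact: bounded_kernel_col.
pose A x := \int[mu]_z (F x z * F x z); pose B y := \int[mu]_z (G z y * G z y).
have bA x : `|A x| <= CF * CF.
  apply: Rintegral_bound => [|z]; last by rewrite normrM ler_pM.
  by apply: measurable_funM; exact: bounded_kernel_row.
have bB x : `|B x| <= CG * CG.
  apply: Rintegral_bound => [|z]; last by rewrite normrM ler_pM.
  by apply: measurable_funM; exact: bounded_kernel_col.
have mA : measurable_fun setT A.
  apply: (measurable_Rintegral2 mu mu (fun w => F w.1 w.2 * F w.1 w.2) _ (cst (CF * CF))).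
  - exact: measurable_funM (proj1 bF) (proj1 bF).
  - exact: finite_measure_integrable_cst.
  - by move=> x y; rewrite /= normrM ler_pM.
have mB : measurable_fun setT B.
  apply: (measurable_Rintegral1 mu mu (fun w => G w.1 w.2 * G w.1 w.2) _ (cst (CG * CG))).
  - exact: measurable_funM (proj1 bG) (proj1 bG).
  - exact: finite_measure_integrable_cst.
  - by move=> x y; rewrite /= normrM ler_pM.
have IA := bounded_integrable mu mA bA; have IB := bounded_integrable mu mB bB.
have -> : hsdot G G = \int[mu]_y B y.
  rewrite hsdotE// (Rintegral_swap mu mu (fun w => G w.1 w.2 * G w.1 w.2) _ (cst (CG * CG)))//.
  - exact: measurable_funM (proj1 bG) (proj1 bG).
  - exact: finite_measure_integrable_cst.
  - by move=> x y; rewrite /= normrM ler_pM.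
rewrite !hsdotE// -RintegralZr//.
have [C C0 FGC] := bounded_kernel_bound bFG.
apply: le_Rintegral => //.
- apply: (bounded_integrable mu (C := C * C)).
    apply: (measurable_Rintegral2 mu mu
      (fun w => comp F G w.1 w.2 * comp F G w.1 w.2) _ (cst (C * C))).
    - exact: measurable_funM (proj1 bFG) (proj1 bFG).
    - exact: finite_measure_integrable_cst.
    - by move=> x y; rewrite /= normrM ler_pM.
  move=> x; apply: Rintegral_bound => [|z]; last by rewrite normrM ler_pM.
  by apply: measurable_funM; exact: bounded_kernel_row.
- apply: (bounded_integrable mu (C := CF * CF * `|\int[mu]_y B y|)).
    exact: measurable_funM.
  by move=> x; rewrite normrM ler_wpM2r//; exact: bA.
move=> x _; rewrite -RintegralZl//; apply: le_Rintegral => //.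
- apply: (bounded_integrable mu (C := C * C)) => [|y].
    by apply: measurable_funM; exact: bounded_kernel_row.
  by rewrite normrM ler_pM.
- by apply: integrableZR.
by move=> y _; rewrite -expr2; exact: CauchySchwarz.
Qed.

End hilbert_schmidt.

(** * Powers of a symmetric kernel and their traces *)

Section kernel_powers.
Context {d} {X : measurableType d} {R : realType}.
Variables (mu : probability X R) (K : X -> X -> R).
Hypotheses (bK : bounded_kernel K) (Ksym : forall x y, K x y = K y x).
Local Notation comp := (kcomp mu).
Local Notation hs := (hsdot mu).

(** The index is shifted: [kpow n] is K^(n+1), the identity having no kernel. So [ktrace (n + n).+1]
    is the trace of K^(2n+2). *)
Fixpoint kpow n : X -> X -> R := if n is m.+1 then comp K (kpow m) else K.

Lemma bounded_kpow n : bounded_kernel (kpow n).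
Proof. by elim: n => [//|n IHn] /=; exact: bounded_kernel_comp. Qed.
Local Hint Resolve bounded_kpow : core.

Lemma kcomp_kpow n m : comp (kpow n) (kpow m) = kpow (n + m).+1.
Proof. by elim: n m => [//|n IHn] m; rewrite /= (kcompA mu bK (bounded_kpow n) (bounded_kpow m)) IHn. Qed.

Lemma kpow_sym n x y : kpow n x y = kpow n y x.
Proof.
elim: n x y => [//|n IHn] x y.
(* On the right the last factor K is split off instead of the first, so that the two integrands are
   transposes of each other. *)
rewrite -[in RHS](addn0 n) -kcomp_kpow.
by apply: eq_Rintegral => z _; rewrite /= IHn Ksym mulrC.
Qed.

Definition ktrace n : R := \int[mu]_x kpow n x x.

Lemma hs_kpow n m : hs (kpow n) (kpow m) = ktrace (n + m).+1.
Proof.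
rewrite (hsdotE mu (bounded_kpow n) (bounded_kpow m)); apply: eq_Rintegral => x _.
rewrite -kcomp_kpow; apply: eq_Rintegral => y _.
by rewrite [kpow m x y]kpow_sym.
Qed.

(** Cauchy-Schwarz for K^(n+1) and K^(n+3), whose Hilbert-Schmidt product is the trace of
    K^(2n+4). *)
Lemma ktrace_convex n : ktrace (n.+1 + n.+1).+1 ^+ 2 <=
  ktrace (n + n).+1 * ktrace (n.+2 + n.+2).+1.
Proof.
have -> : (n.+1 + n.+1 = n + n.+2)%N by lia.
by rewrite -!hs_kpow; apply: CauchySchwarz; exact: hs_Lfun2.
Qed.

Lemma ktrace_submul n m : ktrace ((n + m).+1 + (n + m).+1).+1 <=
  ktrace (n + n).+1 * ktrace (m + m).+1.
Proof. by rewrite -!hs_kpow -kcomp_kpow; exact: (hs_comp mu (bounded_kpow n) (bounded_kpow m)). Qed.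

Lemma hs_kop (F : X -> X -> R) (f : X -> R) : bounded_kernel F -> f \in Lfun mu 2%:E ->
  L2dot mu (kop mu F f) (kop mu F f) <= hs F F * L2dot mu f f.
Proof.
move=> bF fL; have If := Lfun2_integrable fL; have FfL := kop_Lfun2 mu bF If.
have [C C0 FC] := bounded_kernel_bound bF.
have FFC x y : `|F x y * F x y| <= C * C by rewrite normrM ler_pM.
have IA : mu.-integrable setT (EFin \o (fun x => \int[mu]_y (F x y * F x y))).
  apply: (bounded_integrable mu (C := C * C)).
    apply: (measurable_Rintegral2 mu mu (fun w => F w.1 w.2 * F w.1 w.2) _ (cst (C * C))).
    - exact: measurable_funM (proj1 bF) (proj1 bF).
    - exact: finite_measure_integrable_cst.
    - by move=> x y; exact: FFC.
  move=> x; apply: Rintegral_bound => //.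
  by apply: measurable_funM; exact: bounded_kernel_row.
rewrite hsdotE// -RintegralZr//; apply: le_Rintegral => //.
- exact: Lfun2_mul_integrable.
- rewrite (_ : _ \o _ = EFin \o (fun x => L2dot mu f f * \int[mu]_y (F x y * F x y))).
    exact: integrableZR.
  by apply/funext => x /=; rewrite mulrC.
move=> x _; rewrite -expr2; apply: CauchySchwarz => //.
by apply: bounded_Lfun2 (FC x); exact: bounded_kernel_row.
Qed.

Lemma kop_sym (f g : X -> R) (C : R) : measurable_fun setT g -> (forall y, `|g y| <= C) ->
  mu.-integrable setT (EFin \o f) ->
  L2dot mu (kop mu K g) f = L2dot mu g (kop mu K f).
Proof.
move=> mg gC If; rewrite (kop_adjoint mu bK mg gC If); congr L2dot.
by apply/funext => x; apply: eq_Rintegral => y _; rewrite Ksym.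
Qed.

(** This trace is the squared Hilbert-Schmidt norm of K^2. If it vanished, K^2 f would vanish almost
    everywhere, and so would K f, since |K f|^2 = <K^2 f, f>. *)
Lemma ktrace3_gt0 (f : X -> R) : f \in Lfun mu 2%:E ->
  ~ {ae mu, forall x, kop mu K f x = 0} -> 0 < ktrace 3.
Proof.
move=> fL Kf0; have If := Lfun2_integrable fL.
have gL := kop_Lfun2 mu bK If; have Ig := Lfun2_integrable gL.
have hL := kop_Lfun2 mu bK Ig.
have [C C0 KC] := bounded_kernel_bound bK.
have -> : ktrace 3 = hs (kpow 1) (kpow 1) by rewrite hs_kpow.
rewrite lt_def L2dot_ge0 andbT; apply/eqP => Q0; apply: Kf0.
apply: L2dot_eq0 => //.
rewrite -(kop_sym (measurable_kop mu bK If) (fun y => kop_bound y bK If KC) If).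
apply: ae0_L2dot => //; apply: L2dot_eq0 => //.
apply/eqP; rewrite eq_le L2dot_ge0 andbT.
have -> : kop mu K (kop mu K f) = kop mu (kpow 1) f.
  by apply/funext => x; rewrite kop_comp.
by rewrite (le_trans (hs_kop _ fL))// Q0 mul0r.
Qed.

Lemma hs_bound (F : X -> X -> R) (C : R) : bounded_kernel F ->
  (forall x y, `|F x y| <= C) -> hs F F <= C ^+ 2.
Proof.
move=> bF FC; apply: le_trans (ler_norm _) _.
apply: Rintegral_bound; first exact: measurable_funM (proj1 bF) (proj1 bF).
by move=> z; rewrite normrM expr2; apply: ler_pM => //; exact: FC.
Qed.

Definition kprod x y z w : R := K x z * K w y.

Lemma bounded_kprod x y : bounded_kernel (kprod x y).
Proof.
have [C C0 KC] := bounded_kernel_bound bK.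
split; last by exists (C * C) => z w; rewrite normrM ler_pM.
apply: measurable_funM.
  by apply: (measurableT_comp (f := K x)) => //; exact: bounded_kernel_row.
by apply: (measurableT_comp (f := K ^~ y)) => //; exact: bounded_kernel_col.
Qed.

(** Multiplying by K on both sides makes the value at a point a Hilbert-Schmidt product;
    Hilbert-Schmidt estimates on F thereby become uniform estimates on K F K. *)
Lemma kcomp2E F x y : bounded_kernel F -> comp (comp K F) K x y = hs F (kprod x y).
Proof.
move=> bF; have [C C0 KC] := bounded_kernel_bound bK.
rewrite hsdotE//; last exact: bounded_kprod.
rewrite kcompA//; apply: eq_Rintegral => z _.
rewrite -RintegralZl//; first by apply: eq_Rintegral => w _; rewrite /kprod; ring.
have [D D0 FD] := bounded_kernel_bound bF.
apply: (bounded_integrable mu (C := D * C)) => [|w]; last by rewrite normrM ler_pM.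
by apply: measurable_funM; [exact: bounded_kernel_row|exact: bounded_kernel_col].
Qed.

Lemma hs_kprod_bound F (C : R) x y : bounded_kernel F -> (forall x y, `|K x y| <= C) ->
  hs F (kprod x y) ^+ 2 <= (C * C) ^+ 2 * hs F F.
Proof.
move=> bF KC; have bE := bounded_kprod x y.
apply: le_trans (CauchySchwarz (hs_Lfun2 _ bF) (hs_Lfun2 _ bE)) _.
rewrite mulrC ler_wpM2r ?L2dot_ge0//; apply: hs_bound => // z w.
by rewrite normrM ler_pM.
Qed.

Lemma ktrace_growth (f : X -> R) : f \in Lfun mu 2%:E ->
  ~ {ae mu, forall x, kop mu K f x = 0} ->
  exists L : R, [/\ 0 < L, forall n, ktrace (n.+1 + n.+1).+1 <= L * ktrace (n + n).+1 &
    forall n, L ^+ n.+1 <= ktrace (n + n).+1].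
Proof.
move=> fL Kf0; have b1 := ktrace3_gt0 fL Kf0.
(* Submultiplicativity at n = m = 0 gives [ktrace 3 <= ktrace 1 * ktrace 1], which excludes
   [ktrace 1 = 0]. *)
have b0 : 0 < ktrace 1.
  rewrite lt_def -(hs_kpow 0 0) L2dot_ge0 andbT; apply/eqP => b0.
  have := lt_le_trans b1 (ktrace_submul 0 0).
  by rewrite -(hs_kpow 0 0) b0 mul0r ltxx.
exact: (growth_rate (b := fun n => ktrace (n + n).+1) b0 b1 ktrace_convex ktrace_submul).
Qed.

End kernel_powers.

(** * An eigenfunction of the squared kernel as a limit of rescaled even powers *)

Section eigenfunction.
Context {d} {X : measurableType d} {R : realType}.
Variables (mu : probability X R) (K : X -> X -> R).
Hypotheses (bK : bounded_kernel K) (Ksym : forall x y, K x y = K y x).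
Local Notation comp := (kcomp mu).
Local Notation hs := (hsdot mu).
Local Notation kpow := (kpow mu K).
Local Notation ktrace := (ktrace mu K).
Variable L : R.
Hypotheses (L0 : 0 < L) (La : forall n, ktrace (n.+1 + n.+1).+1 <= L * ktrace (n + n).+1)
  (Lb : forall n, L ^+ n.+1 <= ktrace (n + n).+1).

(* [a] decreases to a limit at least 1, and [hsdot mu (G n) (G m) = a (n + m).+1], so the
   normalised powers [G n = K^(2n+2) / L^(n+1)] form a Cauchy sequence in Hilbert-Schmidt
   norm.  As [G n.+1 = L^-1 K (G n) K], they even converge uniformly, which dispenses with the
   completeness of L^2; the limit [P] satisfies [K^2 P = L P] and has trace at least 1. *)
Let a n := ktrace (n + n).+1 / L ^+ n.+1.
Let G n x y := kpow (n + n).+1 x y / L ^+ n.+1.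

Let Ln n : 0 < L ^+ n. Proof. exact: exprn_gt0. Qed.

Let a_ni n m : (n <= m)%N -> a m <= a n.
Proof.
move=> /subnK <-; elim: (m - n)%N => [//|k IH]; apply: le_trans IH.
rewrite /a addSn [L ^+ (k + n).+2]exprS ler_pdivrMr ?mulr_gt0//.
by rewrite mulrCA divfK ?gt_eqF.
Qed.

Let a_ge1 n : 1 <= a n.
Proof. by rewrite /a ler_pdivlMr// mul1r. Qed.

Let a_cvg : cvgn a.
Proof. by apply: nonincreasing_is_cvgn a_ni _; exists 1 => _ [n _ <-]. Qed.

Let bkp n : bounded_kernel (kpow n). Proof. exact: bounded_kpow. Qed.

Let bG n : bounded_kernel (G n).
Proof.
have [mk [C kC]] := bkp (n + n).+1; split.
  by apply: measurable_funM.
exists (C * `|(L ^+ n.+1)^-1|) => x y.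
by rewrite normrM ler_wpM2r.
Qed.

Let bGB n m : bounded_kernel (fun x y => G n x y - G m x y).
Proof.
have [mn [C nC]] := bG n; have [mm [D mD]] := bG m; split.
  exact: measurable_funB.
exists (C + D) => x y; apply: le_trans (ler_normB _ _) _.
by rewrite lerD.
Qed.

Let hsG n m : hs (G n) (G m) = a (n + m).+1.
Proof.
rewrite /a; have -> : ((n + m).+1 + (n + m).+1 = (n + n).+1 + (m + m).+1)%N by lia.
rewrite -(hs_kpow mu bK Ksym) -RintegralZr//; last first.
  by apply: Lfun2_mul_integrable; exact: hs_Lfun2.
apply: eq_Rintegral => z _; rewrite /uncurryk /G.
have -> : L ^+ (n + m).+2 = L ^+ n.+1 * L ^+ m.+1 by rewrite -exprD; congr (_ ^+ _); lia.
by field; rewrite !gt_eqF.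
Qed.

Let hsGB n m : hs (fun x y => G n x y - G m x y) (fun x y => G n x y - G m x y) =
  a (n + n).+1 - 2 * a (n + m).+1 + a (m + m).+1.
Proof. by rewrite /hsdot L2dot_subsub; [rewrite -!hsG|exact: hs_Lfun2|exact: hs_Lfun2]. Qed.

Let G_step n : G n.+1 = fun x y => L^-1 * hs (G n) (kprod K x y).
Proof.
apply/funext => x; apply/funext => y; rewrite -(kcomp2E mu bK _ _ (bG n)) /G.
have -> : (n.+1 + n.+1).+1 = ((n + n).+1 + 0).+2 by lia.
have -> : kpow ((n + n).+1 + 0).+2 = comp (comp K (kpow (n + n).+1)) K.
  by rewrite (kcompA mu bK (bkp _) bK) (kcomp_kpow mu bK _ 0).
rewrite exprS invfM mulrCA; congr (_ * _).
rewrite -RintegralZr; last 2 first.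
- by [].
- have [C _ kC] := bounded_kernel_bound (bounded_kernel_comp mu mu mu bK (bkp (n + n).+1)).
  have [D _ KD] := bounded_kernel_bound bK.
  apply: (bounded_integrable mu (C := C * D)) => [|z]; last by rewrite normrM ler_pM.
  by apply: measurable_funM; [apply: bounded_kernel_row; exact: bounded_kernel_comp|
    exact: bounded_kernel_col].
apply: eq_Rintegral => z _; rewrite mulrAC; congr (_ * _).
rewrite -RintegralZr//; last first.
  have [C _ kC] := bounded_kernel_bound (bkp (n + n).+1).
  have [D _ KD] := bounded_kernel_bound bK.
  apply: (bounded_integrable mu (C := D * C)) => [|w]; last by rewrite normrM ler_pM.
  by apply: measurable_funM; [exact: bounded_kernel_row|exact: bounded_kernel_col].
by apply: eq_Rintegral => w _; rewrite mulrA.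
Qed.

Let C : R := proj1_sig (cid2 (bounded_kernel_bound bK)).
Let KC x y : `|K x y| <= C. Proof. by rewrite /C; case: cid2. Qed.
(** The square of the factor L^-1 in [G_step] times the bound of [hs_kprod_bound]. *)
Let M := L^-1 ^+ 2 * (C * C) ^+ 2.

Let G_bound n x y : `|G n.+1 x y| <= Num.sqrt (M * a 0).
Proof.
rewrite -sqrtr_sqr ler_wsqrtr// G_step exprMn /M -mulrA ler_wpM2l ?sqr_ge0//.
apply: le_trans (hs_kprod_bound mu bK x y (bG n) KC) _.
by rewrite ler_wpM2l ?sqr_ge0// hsG a_ni.
Qed.

Let G_dist n m x y : (n <= m)%N ->
  (G n.+1 x y - G m.+1 x y) ^+ 2 <= M * (a n - limn a).
Proof.
move=> nm; rewrite !G_step -mulrBr exprMn /M -mulrA ler_wpM2l ?sqr_ge0//.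
have bE := bounded_kprod bK x y.
have -> : hs (G n) (kprod K x y) - hs (G m) (kprod K x y) =
    hs (fun x y => G n x y - G m x y) (kprod K x y).
  by rewrite /hsdot L2dotBl//; exact: hs_Lfun2.
apply: le_trans (hs_kprod_bound mu bK x y (bGB n m) KC) _.
rewrite ler_wpM2l ?sqr_ge0// hsGB.
(* As [a] decreases, the squared Hilbert-Schmidt distance a (2n+1) - 2 a (n+m+1) + a (2m+1) is at
   most a n - a (n+m+1), hence at most a n - lim a. *)
have a1 : a (n + n).+1 <= a n by apply: a_ni; lia.
have a2 : a (m + m).+1 <= a (n + m).+1 by apply: a_ni; lia.
have a3 : limn a <= a (n + m).+1.
  exact: nonincreasing_cvgn_ge a_ni a_cvg _.
lra.
Qed.

Let G_cvg x y : cvgn (fun n => G n.+1 x y).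
Proof.
apply: (@cvg_sqr_dist _ _ (fun n => M * (a n - limn a))); last first.
  by move=> n m nm; exact: G_dist.
rewrite -[0](mulr0 M); apply: cvgMr.
by rewrite -[0](subrr (limn a)); apply: cvgB; [exact: a_cvg|exact: cvg_cst].
Qed.

Let P x y : R := limn (fun n => G n.+1 x y).

Let G_cvgP x y : G n.+1 x y @[n --> \oo] --> P x y. Proof. exact: G_cvg. Qed.

Let bP : bounded_kernel P.
Proof.
split.
  apply: (measurable_fun_cvg (h := fun n z => G n.+1 z.1 z.2)).
    by move=> n; case: (bG n.+1).
  by move=> z _; exact: G_cvgP.
exists (Num.sqrt (M * a 0)) => x y.
apply: (cvgr_to_le (cvg_norm (@G_cvgP x y))).
by apply: nearW => n; exact: G_bound.
Qed.

Let P_eigen x y : comp (comp K K) P x y = L * P x y.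
Proof.
have bQ : bounded_kernel (comp K K) by exact: (bkp 1).
have [D D0 QD] := bounded_kernel_bound bQ.
have cP : comp (comp K K) (G n.+1) x y @[n --> \oo] --> comp (comp K K) P x y.
  apply: (cvg_Rintegral (g := cst (D * Num.sqrt (M * a 0)))).
  - by move=> n; apply: measurable_funM; [exact: bounded_kernel_row|exact: bounded_kernel_col].
  - by apply: measurable_funM; [exact: bounded_kernel_row|exact: bounded_kernel_col].
  - by move=> z; apply: cvgMr; exact: G_cvgP.
  - exact: finite_measure_integrable_cst.
  - by move=> n z; rewrite normrM ler_pM.
(* Multiplication by K^2 raises the exponent by two; renormalising costs one factor L and shifts the
   index. *)
have GL n : comp (comp K K) (G n.+1) x y = L * G n.+2 x y.
  have -> : L * G n.+2 x y = kpow (n.+2 + n.+2).+1 x y / L ^+ n.+2.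
    by rewrite /G [L ^+ n.+3]exprS; field; rewrite !gt_eqF.
  rewrite /G; have -> : (n.+2 + n.+2).+1 = (1 + (n.+1 + n.+1).+1).+1 by lia.
  rewrite -(kcomp_kpow mu bK 1) -RintegralZr//.
    by apply: eq_Rintegral => z _; exact: mulrA.
  have [E E0 kE] := bounded_kernel_bound (bkp (n.+1 + n.+1).+1).
  apply: (bounded_integrable mu (C := D * E)) => [|z]; last first.
    by rewrite normrM; apply: ler_pM => //; exact: QD.
  by apply: measurable_funM; [exact: bounded_kernel_row|exact: bounded_kernel_col].
have cL : comp (comp K K) (G n.+1) x y @[n --> \oo] --> L * P x y.
  under eq_fun do rewrite GL.
  apply: cvgMr; have := @G_cvgP x y.
  by rewrite -(cvg_shiftS (fun n => G n.+1 x y)).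
by have := cvg_unique _ cP cL; apply.
Qed.

(** The trace of [G n] is [a n], and the bound [a n >= 1] survives the limit. This is what prevents
    the limit kernel from being zero. *)
Let P_trace : 1 <= \int[mu]_x P x x.
Proof.
have mdiag (F : X -> X -> R) : bounded_kernel F -> measurable_fun setT (fun x => F x x).
  by move=> bF; exact: (bounded_kernel_meas_comp bF).
have cP : \int[mu]_x G n.+1 x x @[n --> \oo] --> \int[mu]_x P x x.
  apply: (cvg_Rintegral (g := cst (Num.sqrt (M * a 0)))).
  - by move=> n; exact: mdiag.
  - exact: mdiag.
  - by move=> z; exact: G_cvgP.
  - exact: finite_measure_integrable_cst.
  - by move=> n z; exact: G_bound.
apply: (cvgr_to_ge cP); apply: nearW => n.
rewrite RintegralZr//; first exact: a_ge1.
have [E E0 kE] := bounded_kernel_bound (bkp (n.+1 + n.+1).+1).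
by apply: (bounded_integrable mu (C := E)) => //; exact: mdiag.
Qed.

(** Every column of P solves the equation, and a nonzero diagonal value P x0 x0 singles out a column
    that is not zero. Nonvanishing at one point is enough: the equation holds everywhere, so a
    solution that vanished almost everywhere would vanish at that point too. *)
Lemma kcomp_eigenfunction : exists h : X -> R, [/\ measurable_fun setT h,
  exists C, forall x, `|h x| <= C, exists x, h x != 0 &
  forall x, kop mu (comp K K) h x = L * h x].
Proof.
have [x0 Px0] : exists x, P x x != 0.
  apply: contrapT => /forallNP P0; have := P_trace.
  have -> : \int[mu]_x P x x = \int[mu]_x cst 0 x.
    by apply: eq_Rintegral => x _; apply/eqP; have /negP := P0 x; rewrite negbK.
  by rewrite Rintegral_cst// mul0r ler10.
exists (P ^~ x0); split.
- exact: bounded_kernel_col.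
- by have [_ [B PB]] := bP; exists B.
- by exists x0.
- by move=> x; exact: P_eigen.
Qed.

End eigenfunction.

(* An eigenfunction [h] of the square of [K] for the eigenvalue [l^2] gives one of [K] for
   [l], namely [K h + l h], unless this function vanishes and [h] is one for [- l]. *)
Lemma bounded_kernel_eigenfunction {d} {X : measurableType d} {R : realType}
    (mu : probability X R) (K : X -> X -> R) (f : X -> R) :
  bounded_kernel K -> (forall x y, K x y = K y x) -> f \in Lfun mu 2%:E ->
  ~ {ae mu, forall x, kop mu K f x = 0} ->
  exists l (h : X -> R), [/\ l != 0, measurable_fun setT h,
  exists C, forall x, `|h x| <= C, exists x, h x != 0 &
  forall x, kop mu K h x = l * h x].
Proof.
move=> bK Ksym fL Kf0; have [L [L0 La Lb]] := ktrace_growth bK Ksym fL Kf0.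
have [h [mh [C hC] [x0 hx0] Kh]] := kcomp_eigenfunction bK Ksym L0 La Lb.
pose l := Num.sqrt L; have l0 : 0 < l by rewrite sqrtr_gt0.
have Ih := bounded_integrable mu mh hC.
have KKh x : kop mu K (kop mu K h) x = l ^+ 2 * h x.
  by rewrite -kop_comp// Kh sqr_sqrtr// ltW.
have mKh := measurable_kop mu bK Ih.
have IKh := kop_integrable1 mu bK Ih.
pose g x := kop mu K h x + l * h x.
have Kg x : kop mu K g x = l * g x.
  rewrite /g /kop; under eq_Rintegral do rewrite mulrDr mulrCA.
  rewrite RintegralD ?RintegralZl//.
  - by rewrite -/(kop mu K h x) -/(kop mu K (kop mu K h) x) KKh; ring.
  - exact: kop_integrable.
  - exact: kop_integrable.
  - by apply: integrableZR; exact: kop_integrable.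
have [g0|g0] := pselect (forall x, g x = 0).
  exists (- l), h; split => //; [by rewrite oppr_eq0 gt_eqF|by exists C|by exists x0|].
  by move=> x; have /eqP := g0 x; rewrite addr_eq0 mulNr => /eqP.
exists l, g; split => //; first by rewrite gt_eqF.
- by apply: measurable_funD => //; exact: measurable_funM.
- have [D D0 KD] := bounded_kernel_bound bK.
  exists (D * \int[mu]_y `|h y| + `|l| * C) => x.
  rewrite (le_trans (ler_normD _ _))// lerD//; first exact: kop_bound.
  by rewrite normrM ler_wpM2l.
- apply: contrapT => /forallNP g1; apply: g0 => x; apply/eqP.
  by have /negP := g1 x; rewrite negbK.
Qed.

(** * The trace formula for Gram kernels *)

Lemma nneseries_EFin {R : realType} (f : nat -> R) (l : R) :
  series f @ \oo --> l -> (\sum_(k <oo) (f k)%:E = l%:E)%E.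
Proof.
move=> fl; apply/cvg_lim => //; under eq_fun do rewrite sumEFin.
by apply: cvg_EFin fl; exact: nearW.
Qed.

(** Double sums are exchanged in the extended reals; nonnegativity supplies the convergence needed
    to return to a real limit. *)
Lemma EFin_nneseries {R : realType} (f : nat -> R) (l : R) : (forall k, 0 <= f k) ->
  (\sum_(k <oo) (f k)%:E = l%:E)%E -> series f @ \oo --> l.
Proof.
move=> f0 fl; have : cvgn (fun n => \sum_(0 <= k < n) (f k)%:E)%E.
  by apply: is_cvg_nneseries => *; rewrite lee_fin.
move=> /cvg_ex[l' cl]; have : l' = l%:E by rewrite -fl; apply/esym/cvg_lim.
by move=> ll'; move: cl; rewrite ll'; under eq_fun do rewrite sumEFin; move/fine_cvg.
Qed.

Section parseval.
Context {d} {T : measurableType d} {R : realType}.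
Variable mu : {measure set T -> \bar R}.
Local Notation dot := (L2dot mu).

Lemma orthonormal_basis_orthonormal (e : nat -> T -> R) n :
  orthonormal_basis mu e -> orthonormal mu n e.
Proof. by move=> [eL eo _]; split. Qed.

(** The third clause of [orthonormal_basis] says that the norm of the residual tends to 0, and its
    square is <f, f> minus the partial sum. *)
Lemma Parseval (e : nat -> T -> R) f : orthonormal_basis mu e ->
  f \in Lfun mu 2%:E ->
  \sum_(k < n) dot f (e k) ^+ 2 @[n --> \oo] --> dot f f.
Proof.
move=> eb fL; have [eL eo ec] := eb.
pose D n := dot (fun x => f x - projn mu n e f x) (fun x => f x - projn mu n e f x).
have DL n : (fun x => f x - projn mu n e f x) \in Lfun mu 2%:E.
  by apply: Lfun2B => //; apply: Lfun2_projn; exact: orthonormal_basis_orthonormal.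
have sD : Num.sqrt (D n) @[n --> \oo] --> 0.
  have := ec f fL; rewrite (_ : (fun n => _) = fun n => (Num.sqrt (D n))%:E).
    by move=> /fine_cvg.
  by apply/funext => n; rewrite Lnorm2E//; [case/Lfun2P : (DL n)|case/Lfun2P : (DL n)].
have D0 : D n @[n --> \oo] --> 0.
  rewrite -[0](expr0n _ 2) (_ : D = fun n => Num.sqrt (D n) ^+ 2).
    by under eq_fun do rewrite expr2; rewrite expr2; exact: cvgM.
  by apply/funext => n; rewrite sqr_sqrtr// L2dot_ge0.
have -> : (fun n => \sum_(k < n) dot f (e k) ^+ 2) = fun n => dot f f - D n.
  apply/funext => n; rewrite /D dist_projn//.
  by rewrite opprB addrCA subrr addr0.
by rewrite -[X in _ --> X]subr0; apply: cvgB => //; exact: cvg_cst.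
Qed.

End parseval.

Section trace_formula.
Context {dX dY} {X : measurableType dX} {Y : measurableType dY} {R : realType}.
Variables (mu : probability X R) (rho : probability Y R) (phi : X -> Y -> R).
Hypothesis bphi : bounded_kernel phi.
Let K : X -> X -> R := kcomp rho phi (fun s x => phi x s).
Let B : (X -> R) -> Y -> R := kop mu (fun s x => phi x s).
Let bphiT := bounded_kernel_tr bphi.

Lemma bounded_gram : bounded_kernel K.
Proof. exact: bounded_kernel_comp. Qed.

Lemma gram_sym x y : K x y = K y x.
Proof. by apply: eq_Rintegral => s _; rewrite mulrC. Qed.

Lemma kop_gram f x : f \in Lfun mu 2%:E -> kop mu K f x = kop rho phi (B f) x.
Proof. by move=> fL; apply: kop_comp => //; exact: Lfun2_integrable. Qed.

Lemma kop_gram_dot f g : f \in Lfun mu 2%:E -> g \in Lfun mu 2%:E ->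
  L2dot mu (kop mu K f) g = L2dot rho (B f) (B g).
Proof.
move=> fL gL; have [C C0 phiC] := bounded_kernel_bound bphiT.
rewrite -(kop_adjoint rho bphi (measurable_kop rho bphiT (Lfun2_integrable fL))
  (fun y => kop_bound y bphiT (Lfun2_integrable fL) phiC) (Lfun2_integrable gL)).
by congr L2dot; apply/funext => x; exact: kop_gram.
Qed.

Lemma gram_trace_series u : orthonormal_basis mu u ->
  series (fun n => L2dot mu (kop mu K (u n)) (u n)) @ \oo --> \int[mu]_x K x x.
Proof.
move=> ub; have [uL _ _] := ub; have [C C0 phiC] := bounded_kernel_bound bphi.
have BL n : B (u n) \in Lfun rho 2%:E by apply: kop_Lfun2 => //; exact: Lfun2_integrable.
have phiL s : phi ^~ s \in Lfun mu 2%:E.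
  by apply: bounded_Lfun2 (phiC ^~ s); exact: bounded_kernel_col.
have phiphi x s : `|phi x s * phi x s| <= C * C by rewrite normrM ler_pM.
have -> : \int[mu]_x K x x = \int[rho]_s \int[mu]_x (phi x s * phi x s).
  rewrite /K (Rintegral_swap mu rho (fun w => phi w.1 w.2 * phi w.1 w.2) _ (cst (C * C)))//.
  - exact: measurable_funM (proj1 bphi) (proj1 bphi).
  - exact: finite_measure_integrable_cst.
have -> : series (fun n => L2dot mu (kop mu K (u n)) (u n)) =
    fun n => \int[rho]_s \sum_(k < n) B (u k) s ^+ 2.
  apply/funext => n; rewrite /series/= big_mkord Rintegral_sum => [|k].
    by apply: eq_bigr => k _; rewrite kop_gram_dot//; apply: eq_Rintegral => s _; rewrite expr2.
  exact: Lfun2_integrable_sqr.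
(* By definition, B (u n) s is the n-th coefficient of [phi ^~ s]. Parseval thus applies at each
   fixed s, and Bessel supplies the constant majorant C * C. *)
have BE n s : B (u n) s = L2dot mu (phi ^~ s) (u n) by [].
apply: (cvg_Rintegral (g := cst (C * C))).
- move=> n; apply: measurable_sum => k; apply: measurable_funX.
  exact: Lfun2_measurable (BL k).
- apply: (measurable_Rintegral1 mu rho (fun w => phi w.1 w.2 * phi w.1 w.2) _ (cst (C * C))) => //.
  - exact: measurable_funM (proj1 bphi) (proj1 bphi).
  - exact: finite_measure_integrable_cst.
- by move=> s; exact: Parseval.
- exact: finite_measure_integrable_cst.
move=> n s; rewrite ger0_norm; last by apply: sumr_ge0 => k _; exact: sqr_ge0.
apply: le_trans (Bessel (orthonormal_basis_orthonormal n ub) (phiL s)) _.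
apply: le_trans (ler_norm _) _; apply: Rintegral_bound => //.
by apply: measurable_funM; exact: Lfun2_measurable (phiL s).
Qed.

(** For a unit eigenfunction, l = <K f, f> = |B f|^2. *)
Lemma gram_eigenvalue_gt0 l f : l != 0 -> f \in Lfun mu 2%:E ->
  {ae mu, forall x, kop mu K f x = l * f x} -> L2dot mu f f = 1 -> 0 < l.
Proof.
move=> l0 fL Kf f1; rewrite lt_def l0 -[leRHS]mulr1 -f1 -L2dotZl//.
rewrite -(ae_eq_L2dot _ _ fL fL Kf)//; last 3 first.
- by apply: kop_Lfun2; [exact: bounded_gram|exact: Lfun2_integrable].
- exact: Lfun2Z.
- exact: aeW.
by rewrite kop_gram_dot// L2dot_ge0.
Qed.

(** * Spectral expansion of a Gram kernel along its eigenfunctions *)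

Section eigenbasis.
(** [Kv] is demanded at every point because the expansion is bounded pointwise below. [vcomp] says
    that the v_k exhaust the eigenspaces of nonzero eigenvalues; it is the form in which
    multiplicities are used. *)
Variables (lam : nat -> R) (v : nat -> X -> R).
Hypotheses (lam0 : forall k, 0 < lam k) (vo : forall n, orthonormal mu n v)
  (Kv : forall k x, kop mu K (v k) x = lam k * v k x)
  (vcomp : forall l h, l != 0 -> h \in Lfun mu 2%:E ->
     {ae mu, forall x, kop mu K h x = l * h x} ->
     (forall k, L2dot mu h (v k) = 0) -> {ae mu, forall x, h x = 0}).

Let vL k : v k \in Lfun mu 2%:E. Proof. by case: (vo k.+1) => vL _; exact: vL. Qed.

Let vdot i j : L2dot mu (v i) (v j) = (i == j)%:R.
Proof. by case: (vo (maxn i j).+1) => _; apply; rewrite ltnS ?leq_maxl ?leq_maxr. Qed.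

(** The images of the v_k under B, normalised: <B v_i, B v_j> = <K v_i, v_j> is lam_i if i = j and 0
    otherwise. *)
Let gv k s := (Num.sqrt (lam k))^-1 * B (v k) s.

Let slam k : Num.sqrt (lam k) != 0.
Proof. by rewrite gt_eqF// sqrtr_gt0. Qed.

Let BvL k : B (v k) \in Lfun rho 2%:E.
Proof. by apply: kop_Lfun2 => //; exact: Lfun2_integrable. Qed.

Let gvo n : orthonormal rho n gv.
Proof.
split=> [i _|i j _ _]; first by apply: Lfun2Z; exact: BvL.
rewrite L2dotZl ?L2dotZr ?Lfun2Z// -kop_gram_dot//.
have -> : kop mu K (v i) = fun x => lam i * v i x by apply/funext => x; exact: Kv.
rewrite L2dotZl// vdot; case: eqP => [<-|_]; last by rewrite !mulr0.
by rewrite mulr1 mulrA -invfM -expr2 sqr_sqrtr ?mulVf ?gt_eqF ?ltW.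
Qed.

Let C : R := proj1_sig (cid2 (bounded_kernel_bound bounded_gram)).
Let KC x y : `|K x y| <= C. Proof. by rewrite /C; case: cid2. Qed.

(** The coefficient of [phi x] along B (v k) is (K v_k)(x) = lam_k v_k(x), so the summands are the
    squared coefficients along [gv k]. Bessel bounds their sum by |phi x|^2 = K x x. *)
Let bessel n x : \sum_(k < n) lam k * v k x ^+ 2 <= C.
Proof.
have phiL : phi x \in Lfun rho 2%:E.
  have [D D0 phiD] := bounded_kernel_bound bphi.
  by apply: bounded_Lfun2 (phiD x); exact: bounded_kernel_row.
have -> : \sum_(k < n) lam k * v k x ^+ 2 = \sum_(k < n) L2dot rho (phi x) (gv k) ^+ 2.
  apply: eq_bigr => k _; rewrite L2dotZr//.
  have -> : L2dot rho (phi x) (B (v k)) = lam k * v k x by rewrite -Kv kop_gram.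
  have S : (Num.sqrt (lam k))^-1 ^+ 2 = (lam k)^-1.
    by rewrite exprVn sqr_sqrtr ?ltW.
  by rewrite [RHS]exprMn S; field; rewrite gt_eqF.
apply: le_trans (Bessel (gvo n) phiL) _.
exact: le_trans (ler_norm _) (KC x x).
Qed.

Let Dn n x y := \sum_(k < n) lam k * v k x * v k y.

(** Off the diagonal, |p q| <= (p^2 + q^2) / 2 reduces the claim to [bessel] at x and at y. *)
Let Dn_abs n x y : \sum_(k < n) `|lam k * v k x * v k y| <= C.
Proof.
apply: (@le_trans _ _ (\sum_(k < n) (lam k * v k x ^+ 2 + lam k * v k y ^+ 2) / 2)).
  apply: ler_sum => k _; have l0 := lam0 k.
  move: (v k x) (v k y) (lam k) l0 => p q l /ltW l0; rewrite ler_norml.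
  have := mulr_ge0 l0 (sqr_ge0 (p + q)); have := mulr_ge0 l0 (sqr_ge0 (p - q)).
  by rewrite !expr2 => *; apply/andP; split; lra.
rewrite -mulr_suml big_split/= ler_pdivrMr//.
by have := bessel n x; have := bessel n y; lra.
Qed.

Let Dn_bound n x y : `|Dn n x y| <= C.
Proof. exact: le_trans (ler_norm_sum _ _ _) (Dn_abs n x y). Qed.

Let D x y : R := limn (fun n => Dn n x y).

Let Dn_cvg x y : Dn n x y @[n --> \oo] --> D x y.
Proof.
have E : (fun n => Dn n x y) = series (fun k => lam k * v k x * v k y).
  by apply/funext => n; rewrite /series/= big_mkord.
suff : cvgn (fun n => Dn n x y) by [].
rewrite E; apply: normed_cvg; apply: nondecreasing_is_cvgn.
  by apply: nondecreasing_series => k _ _; exact: normr_ge0.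
exists C => _ [n _ <-]; apply: le_trans (Dn_abs n x y).
by rewrite -(big_mkord xpredT (fun k => `|lam k * v k x * v k y|)).
Qed.

Let C0 : 0 <= C. Proof. by rewrite /C; case: cid2. Qed.

Let bDn n : bounded_kernel (Dn n).
Proof.
split; last by exists C => x y; exact: Dn_bound.
have mv k : measurable_fun setT (v k) by exact: (Lfun2_measurable (vL k)).
apply: measurable_sum => k; apply: measurable_funM; first apply: measurable_funM => //.
  exact: (measurableT_comp (mv k)).
exact: (measurableT_comp (mv k)).
Qed.

Let bD : bounded_kernel D.
Proof.
split.
  apply: (measurable_fun_cvg (h := fun n z => Dn n z.1 z.2)).
    by move=> n; case: (bDn n).
  by move=> z _; exact: Dn_cvg.
exists C => x y; apply: (cvgr_to_le (cvg_norm (@Dn_cvg x y))).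
by apply: nearW => n; exact: Dn_bound.
Qed.

Let bL : bounded_kernel K := bounded_gram.

Let bKD : bounded_kernel (fun x y => K x y - D x y).
Proof.
split; first exact: measurable_funB (proj1 bL) (proj1 bD).
have [C' _ DC] := bounded_kernel_bound bD.
by exists (C + C') => x y; rewrite (le_trans (ler_normB _ _))// lerD.
Qed.

Let D_sym x y : D x y = D y x.
Proof.
congr (limn _); apply/funext => n; apply: eq_bigr => k _.
by ring.
Qed.

Let kopDn n f x : f \in Lfun mu 2%:E ->
  kop mu (Dn n) f x = \sum_(k < n) lam k * v k x * L2dot mu f (v k).
Proof.
move=> fL; rewrite /kop.
under eq_Rintegral do rewrite mulr_suml.
rewrite Rintegral_sum => [|k].
  apply: eq_bigr => k _; rewrite -RintegralZl//.
    by apply: eq_Rintegral => y _; rewrite -mulrA [f y * _]mulrC.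
  exact: Lfun2_mul_integrable.
rewrite (_ : _ \o _ = EFin \o (fun y => (lam k * v k x) * (v k y * f y))).
  by apply: integrableZR; exact: Lfun2_mul_integrable.
by apply/funext => y /=; rewrite mulrA.
Qed.

Let kopD f x : f \in Lfun mu 2%:E ->
  \sum_(k < n) lam k * v k x * L2dot mu f (v k) @[n --> \oo] --> kop mu D f x.
Proof.
move=> fL; have If := Lfun2_integrable fL; have mf := Lfun2_measurable fL.
under eq_fun do rewrite -kopDn//.
apply: (cvg_Rintegral (g := fun y => C * `|f y|)).
- by move=> n; apply: measurable_funM => //; exact: bounded_kernel_row.
- by apply: measurable_funM => //; exact: bounded_kernel_row.
- by move=> y; apply: cvgMl; exact: Dn_cvg.
- by apply: integrableZR; exact: integrable_norm.
- by move=> n y; rewrite normrM ler_wpM2r.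
Qed.

Let kopKD f x : f \in Lfun mu 2%:E ->
  kop mu (fun x y => K x y - D x y) f x = kop mu K f x - kop mu D f x.
Proof.
move=> fL; have If := Lfun2_integrable fL.
by rewrite /kop -RintegralB//; [apply: eq_Rintegral => y _; rewrite mulrBl|
  exact: kop_integrable|exact: kop_integrable].
Qed.

Let KDv j x : kop mu (fun x y => K x y - D x y) (v j) x = 0.
Proof.
rewrite kopKD// Kv; apply/eqP; rewrite subr_eq0; apply/eqP.
suff cj : \sum_(k < n) lam k * v k x * L2dot mu (v j) (v k) @[n --> \oo] -->
    lam j * v j x.
  by have := cvg_unique _ cj (@kopD _ x (vL j)); apply.
(* By orthonormality only the j-th term survives, so the partial sums are constant beyond j. *)
apply: cvg_near_cst; near=> n; have jn : (j < n)%N by near: n; exact: nbhs_infty_gt.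
rewrite (bigD1 (Ordinal jn))//= vdot eqxx mulr1 big1 ?addr0// => i.
by rewrite -val_eqE /= vdot eq_sym => /negbTE ->; rewrite mulr0.
Unshelve. all: by end_near. Qed.

(* Deflation: a nonzero eigenvalue of K - D would be a new eigenvalue of K. *)
Let KD0 f : f \in Lfun mu 2%:E -> {ae mu, forall x, kop mu K f x = kop mu D f x}.
Proof.
move=> fL; suff : {ae mu, forall x, kop mu (fun x y => K x y - D x y) f x = 0}.
  by apply: filterS => x; rewrite kopKD// => /eqP; rewrite subr_eq0 => /eqP.
apply: contrapT => KDf.
have KDsym x y : K x y - D x y = K y x - D y x by rewrite gram_sym D_sym.
have [l [h [l0 mh [Ch hC] [x0 hx0] KDh]]] := bounded_kernel_eigenfunction bKD KDsym fL KDf.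
have hL : h \in Lfun mu 2%:E by apply: bounded_Lfun2 hC.
(* Symmetry moves K - D onto v_k, which it annihilates: l <h, v_k> = <h, (K - D) v_k> = 0. *)
have he k : L2dot mu h (v k) = 0.
  apply: (mulfI l0); rewrite mulr0 -L2dotZl//.
  have -> : (fun x => l * h x) = kop mu (fun x y => K x y - D x y) h.
    by apply/funext => x; rewrite KDh.
  have -> := kop_sym bKD KDsym mh hC (Lfun2_integrable (vL k)).
  rewrite (_ : kop mu _ (v k) = cst 0); last by apply/funext => x; exact: KDv.
  by rewrite /L2dot; under eq_Rintegral do rewrite mulr0; rewrite Rintegral_cst// mul0r.
have Dh x : kop mu D h x = 0.
  suff c0 : \sum_(k < n) lam k * v k x * L2dot mu h (v k) @[n --> \oo] --> 0.
    by have := cvg_unique _ (@kopD _ x hL) c0; apply.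
  under eq_fun do under eq_bigr do rewrite he mulr0.
  by under eq_fun do rewrite big1//; exact: cvg_cst.
have Kh : {ae mu, forall x, kop mu K h x = l * h x}.
  by apply: aeW => x; rewrite -KDh kopKD// Dh subr0.
have h0 := vcomp l0 hL Kh he.
(* The eigenvalue equation at x0 itself expresses h x0 as an integral of h, which is zero almost
   everywhere. *)
have : l * h x0 = 0.
  rewrite -KDh /kop (ae_eq_Rintegral (g := cst 0)) ?Rintegral_cst ?mul0r//.
    by apply: measurable_funM => //; exact: (bounded_kernel_row x0 bKD).
  by apply: filterS h0 => y ->; rewrite mulr0.
by apply/eqP; rewrite mulf_neq0.
Qed.

Lemma gram_spectral_form f : f \in Lfun mu 2%:E ->
  \sum_(k < n) lam k * L2dot mu f (v k) ^+ 2 @[n --> \oo] -->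
  L2dot mu (kop mu K f) f.
Proof.
move=> fL; have If := Lfun2_integrable fL; have mf := Lfun2_measurable fL.
rewrite (ae_eq_L2dot _ _ fL fL (KD0 fL)); last 3 first.
- exact: kop_Lfun2.
- exact: kop_Lfun2.
- exact: aeW.
have -> : (fun n => \sum_(k < n) lam k * L2dot mu f (v k) ^+ 2) =
    fun n => \int[mu]_x (kop mu (Dn n) f x * f x).
  apply/funext => n; under eq_Rintegral do rewrite kopDn// mulr_suml.
  have E k : (fun x => lam k * v k x * L2dot mu f (v k) * f x) =
      fun x => (lam k * L2dot mu f (v k)) * (f x * v k x).
    by apply/funext => x; ring.
  rewrite Rintegral_sum => [|k].
    apply: eq_bigr => k _; rewrite E RintegralZl//; last exact: Lfun2_mul_integrable.
    by rewrite expr2 mulrA.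
  by rewrite E; apply: integrableZR; exact: Lfun2_mul_integrable.
apply: (cvg_Rintegral (g := fun x => (C * \int[mu]_y `|f y|) * `|f x|)).
- by move=> n; apply: measurable_funM => //; exact: (measurable_kop mu (bDn n) If).
- by apply: measurable_funM => //; exact: (measurable_kop mu bD If).
- move=> x; apply: cvgMl; rewrite (_ : (fun n => _) =
    fun n => \sum_(k < n) lam k * v k x * L2dot mu f (v k)); first exact: kopD.
  by apply/funext => n; rewrite kopDn.
- by apply: integrableZR; exact: integrable_norm.
- move=> n x; rewrite normrM ler_wpM2r//; apply: kop_bound => //; exact: Dn_bound.
Qed.

(** The double series of lam_k <u_n, v_k>^2 has nonnegative terms. Summed over k first it gives <K
    u_n, u_n>; summed over n first it gives lam_k, by Parseval for v_k. *)
Lemma gram_spectral_trace u : orthonormal_basis mu u ->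
  series lam @ \oo --> \int[mu]_x K x x.
Proof.
move=> ub; have [uL _ _] := ub.
pose a n k := lam k * L2dot mu (u n) (v k) ^+ 2.
have a0 n k : 0 <= a n k by rewrite mulr_ge0 ?sqr_ge0 ?ltW.
have row n : (\sum_(k <oo) (a n k)%:E = (L2dot mu (kop mu K (u n)) (u n))%:E)%E.
  apply: nneseries_EFin; rewrite /series/=; under eq_fun do rewrite big_mkord.
  exact: gram_spectral_form.
have col k : (\sum_(n <oo) (a n k)%:E = (lam k)%:E)%E.
  apply: nneseries_EFin; rewrite /series/=.
  under eq_fun do rewrite big_mkord -mulr_sumr.
  under eq_fun do under eq_bigr do rewrite L2dotC.
  have : lam k * \sum_(n < N) L2dot mu (v k) (u n) ^+ 2 @[N --> \oo] -->
    lam k * L2dot mu (v k) (v k) by apply: cvgMr; exact: Parseval.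
  by rewrite vdot eqxx mulr1.
apply: EFin_nneseries => [k|]; first exact: ltW.
under eq_eseriesr do rewrite -col.
rewrite nneseries_interchange; last by move=> *; rewrite lee_fin.
under eq_eseriesr do rewrite row.
by apply: nneseries_EFin; exact: gram_trace_series.
Qed.

End eigenbasis.
End trace_formula.

(** * Orthonormal bases *)

Section gram_schmidt.
Context {d} {T : measurableType d} {R : realType}.
Variable mu : {measure set T -> \bar R}.
Local Notation L2 := (Lfun mu 2%:E).
Local Notation dot := (L2dot mu).
Local Notation proj := (projn mu).
Implicit Types (f g h : T -> R) (u v e : nat -> T -> R).

Lemma orthonormal_ext n u v : (forall k, (k < n)%N -> u k = v k) ->
  orthonormal mu n u -> orthonormal mu n v.
Proof.
move=> uv [uL uo]; split=> [i ilt|i j ilt jlt]; first by rewrite -uv//; exact: uL.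
by rewrite -!uv// uo.
Qed.

(** Comparing f with its own projection fixes the coefficients, and [inspanP] turns membership into
    an identity between numbers, the equality case of Bessel. *)
Definition inspan n u f := {ae mu, forall x, f x = proj n u f x}.

Lemma inspanP n u f : orthonormal mu n u -> f \in L2 ->
  inspan n u f <-> dot f f = \sum_(k < n) dot f (u k) ^+ 2.
Proof.
move=> uo fL; have pL := Lfun2_projn f uo; have fpL := Lfun2B fL pL.
split=> [fs|ff].
  apply/eqP; rewrite -subr_eq0 -dist_projn//; apply/eqP; apply: ae0_L2dot => //.
  by apply: filterS fs => x fx; apply/eqP; rewrite subr_eq0; apply/eqP.
have : dot (fun x => f x - proj n u f x) (fun x => f x - proj n u f x) = 0.
  by rewrite dist_projn// ff subrr.
by move/(L2dot_eq0 fpL); apply: filterS => x /eqP; rewrite subr_eq0 => /eqP.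
Qed.

(** Equality in Bessel persists when the family grows: the sum of squares can only increase and
    remains bounded by <f, f>. *)
Lemma inspan_le n m u v f : (n <= m)%N -> orthonormal mu n u -> orthonormal mu m v ->
  (forall k, (k < n)%N -> u k = v k) -> f \in L2 -> inspan n u f -> inspan m v f.
Proof.
move=> nm uo vo uv fL /(inspanP uo fL) fE; apply/(inspanP vo fL).
apply/eqP; rewrite eq_le (Bessel vo fL) andbT fE.
under eq_bigr do rewrite uv//.
rewrite -(big_mkord xpredT (fun k => dot f (v k) ^+ 2)).
rewrite -[leRHS](big_mkord xpredT (fun k => dot f (v k) ^+ 2)).
by rewrite (big_cat_nat _ nm)//= lerDl sumr_ge0// => k _; exact: sqr_ge0.
Qed.

Lemma projnD n u f g : orthonormal mu n u -> f \in L2 -> g \in L2 ->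
  proj n u (fun x => f x + g x) = fun x => proj n u f x + proj n u g x.
Proof.
move=> [uL _] fL gL; apply/funext => x; rewrite /projn -big_split; apply: eq_bigr => k _ /=.
by rewrite L2dotDl ?mulrDl//; exact: uL.
Qed.

Lemma projnZ n u c f : orthonormal mu n u -> f \in L2 ->
  proj n u (fun x => c * f x) = fun x => c * proj n u f x.
Proof.
move=> [uL _] fL; apply/funext => x; rewrite /projn mulr_sumr; apply: eq_bigr => k _ /=.
by rewrite L2dotZl ?mulrA//; exact: uL.
Qed.

Lemma inspanD n u f g : orthonormal mu n u -> f \in L2 -> g \in L2 ->
  inspan n u f -> inspan n u g -> inspan n u (fun x => f x + g x).
Proof.
by move=> uo fL gL; rewrite /inspan projnD//; apply: filterS2 => x <- <-.
Qed.

Lemma inspanZ n u c f : orthonormal mu n u -> f \in L2 ->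
  inspan n u f -> inspan n u (fun x => c * f x).
Proof. by move=> uo fL; rewrite /inspan projnZ//; apply: filterS => x <-. Qed.

Lemma inspan_orth n u f : orthonormal mu n u -> f \in L2 -> inspan n u f ->
  (forall k, (k < n)%N -> dot f (u k) = 0) -> {ae mu, forall x, f x = 0}.
Proof.
move=> uo fL /(inspanP uo fL) ff f0; apply: L2dot_eq0 => //.
by rewrite ff big1// => k _; rewrite f0// expr0n.
Qed.

(** The new vector is exposed as a multiple of the residual of f, so that further properties of it,
    such as lying in an eigenspace, can be checked afterwards. *)
Lemma gram_schmidt_step n u f : orthonormal mu n u -> f \in L2 -> ~ inspan n u f ->
  exists c, let g := (fun x => c * (f x - proj n u f x)) in
  let v := (fun k => if (k < n)%N then u k else g) in
  orthonormal mu n.+1 v /\ inspan n.+1 v f.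
Proof.
move=> uo fL fns; have pL := Lfun2_projn f uo; have fpL := Lfun2B fL pL.
have [uL uo'] := uo.
pose r x := f x - proj n u f x.
have rr : 0 < dot r r.
  rewrite lt_def L2dot_ge0 andbT; apply/eqP => r0; apply: fns; apply/inspanP => //.
  by apply/eqP; rewrite -subr_eq0 -dist_projn//; apply/eqP.
have sr : Num.sqrt (dot r r) != 0 by rewrite gt_eqF// sqrtr_gt0.
have ru k : (k < n)%N -> dot r (u k) = 0.
  move=> kn; rewrite /r L2dotBl//; last exact: uL.
  by rewrite L2dot_projn// subrr.
exists (Num.sqrt (dot r r))^-1 => g v.
have gL : g \in L2 by exact: Lfun2Z.
have gu k : (k < n)%N -> dot g (u k) = 0.
  by move=> kn; rewrite L2dotZl ?ru ?mulr0//; exact: uL.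
have gg : dot g g = 1.
  rewrite L2dotZl// L2dotZr// mulrA -invfM -expr2 sqr_sqrtr ?mulVf ?gt_eqF//.
  exact: ltW.
have vo : orthonormal mu n.+1 v.
  split=> [i _|i j]; first by rewrite /v; case: ifP => // /uL.
  rewrite !ltnS (leq_eqVlt i) (leq_eqVlt j) /v => /predU1P[->|ilt] /predU1P[->|jlt].
  - by rewrite ltnn eqxx.
  - by rewrite ltnn jlt gu// gtn_eqF.
  - by rewrite ltnn ilt L2dotC gu// ltn_eqF.
  - by rewrite ilt jlt uo'.
split=> //; apply: aeW => x; rewrite /projn big_ord_recr /=.
rewrite [X in _ = X + _](_ : _ = proj n u f x); last first.
  by apply: eq_bigr => k _; rewrite /v ltn_ord.
have -> : v n = g by rewrite /v ltnn.
(* The projection of f is orthogonal to g, so <f, g> = <r, g> = <r, r> / sqrt <r, r>. *)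
have -> : dot f g = Num.sqrt (dot r r).
  have -> : f = fun x => r x + proj n u f x by apply/funext => y; rewrite /r subrK.
  rewrite L2dotDl// [X in _ + X](_ : _ = 0) ?addr0.
    by rewrite L2dotZr// -[X in _ * X]sqr_sqrtr ?ltW// expr2 mulKf.
  rewrite L2dot_suml//; last by move=> i; exact: uL.
  by rewrite big1// => k _; rewrite [dot (u k) g]L2dotC gu// mulr0.
by rewrite /g mulrA mulfV// mul1r /r addrC subrK.
Qed.

Definition lspan (w : nat -> T -> R) g :=
  exists s : seq (R * nat), g = fun x => \sum_(p <- s) p.1 * w p.2 x.

Lemma lspan_Lfun2 w g : (forall k, w k \in L2) -> lspan w g -> g \in L2.
Proof.
move=> wL [s ->]; elim: s => [|p s IHs].
  rewrite (_ : (fun _ => _) = fun x => \sum_(k < 0) (0 : R) * w k x).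
    by apply: Lfun2_lin => -[].
  by apply/funext => x; rewrite big_nil big_ord0.
rewrite (_ : (fun _ => _) = fun x => p.1 * w p.2 x + \sum_(p <- s) p.1 * w p.2 x).
  by apply: Lfun2D => //; exact: Lfun2Z.
by apply/funext => x; rewrite big_cons.
Qed.

(** A finite combination involves finitely many indices, and N exceeds all of them. *)
Lemma lspan_inspan w g : (forall k, w k \in L2) -> lspan w g ->
  exists N, forall n u, orthonormal mu n u ->
    (forall k, (k < N)%N -> inspan n u (w k)) -> inspan n u g.
Proof.
move=> wL [s ->]; elim: s => [|p s [N IHs]].
  exists 0%N => n u uo _; apply/inspanP => //.
    by apply: (lspan_Lfun2 wL); exists [::].
  have z h : dot (fun x => \sum_(p <- [::]) p.1 * w p.2 x) h = 0.
    rewrite /L2dot; under eq_Rintegral do rewrite big_nil mul0r.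
    by rewrite Rintegral_cst// mul0r.
  by rewrite z big1// => k _; rewrite z expr0n.
exists (maxn p.2.+1 N) => n u uo wu.
rewrite (_ : (fun _ => _) = fun x => p.1 * w p.2 x + \sum_(p <- s) p.1 * w p.2 x).
  apply: inspanD => //; [exact: Lfun2Z|by apply: (lspan_Lfun2 wL); exists s| |].
    by apply: inspanZ => //; apply: wu; rewrite leq_max ltnSn.
  by apply: IHs => // k kN; apply: wu; rewrite leq_max kN orbT.
by apply/funext => x; rewrite big_cons.
Qed.

Lemma dist_projn_inspan n u f g : orthonormal mu n u -> f \in L2 -> g \in L2 ->
  inspan n u g ->
  dot f f - \sum_(k < n) dot f (u k) ^+ 2 <= dot (fun x => f x - g x) (fun x => f x - g x).
Proof.
move=> uo fL gL gs; have pL := Lfun2_projn g uo.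
rewrite -dist_projn//.
apply: le_trans (dist_projn_min (fun k : 'I_n => dot g (u k)) uo fL) _.
rewrite le_eqVlt; apply/orP; left; apply/eqP.
have E : {ae mu, forall x, f x - proj n u g x = f x - g x}.
  by apply: filterS gs => x <-.
apply: (ae_eq_L2dot _ _ _ _ E E); [exact: Lfun2B|exact: Lfun2B|exact: Lfun2B|exact: Lfun2B].
Qed.

Definition total_family w := forall f, f \in L2 -> forall eps : R, 0 < eps ->
  exists2 g, lspan w g & dot (fun x => f x - g x) (fun x => f x - g x) < eps.

Section basis.
Variables (w e : nat -> T -> R).
Hypotheses (wL : forall k, w k \in L2) (wtot : total_family w)
  (eo : forall n, orthonormal mu n e).

(** A dimension count. If u spanned every w i, density would turn Bessel into an equality for all f;
    then n + 1, the sum of the <e_i, e_i> for i <= n, would equal the sum of the <u_k, e_i>^2, which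
    Bessel for e bounds by n. *)
Let not_inspan n u : orthonormal mu n u -> exists i, ~ inspan n u (w i).
Proof.
move=> uo; apply: contrapT => /forallNP wu.
have full f : f \in L2 -> dot f f = \sum_(k < n) dot f (u k) ^+ 2.
  move=> fL; apply/eqP; rewrite eq_le (Bessel uo fL) andbT -subr_le0.
  apply/ler_addgt0Pr => eps e0; rewrite add0r.
  have [g gs /ltW gf] := wtot fL e0.
  apply: le_trans gf; apply: dist_projn_inspan => //; first exact: lspan_Lfun2 gs.
  have [N] := lspan_inspan wL gs; apply => // k _.
  by apply: contrapT; exact: wu.
have [eL eo'] := eo n.+1; have [uL uo'] := uo.
have : \sum_(i < n.+1) dot (e i) (e i) <= n%:R.
  have -> : \sum_(i < n.+1) dot (e i) (e i) =
      \sum_(k < n) \sum_(i < n.+1) dot (u k) (e i) ^+ 2.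
    rewrite exchange_big; apply: eq_bigr => i _; rewrite full//; last exact: eL.
    by apply: eq_bigr => k _; rewrite L2dotC.
  rewrite -[n in leRHS]card_ord -sum1_card natr_sum; apply: ler_sum => k _.
  by apply: le_trans (Bessel (eo n.+1) (uL _ _)) _ => //; rewrite uo'// eqxx.
under eq_bigr do rewrite eo'// eqxx.
by rewrite sumr_const card_ord ler_nat ltnn.
Qed.

Let good n u := orthonormal mu n u /\ forall i, (i < n)%N -> inspan n u (w i).
Let ext n u f : nat -> T -> R := fun k => if (k < n)%N then u k else f.

(** The residual of w i is added for the least i outside the span. Since i >= n, minimality places w
    0, ..., w n in the new span. *)
Let ext_good n u : good n u -> exists f, good n.+1 (ext n u f).
Proof.
move=> [uo uw].
have [i wi imin] : exists2 i, ~ inspan n u (w i) & forall j, (j < i)%N -> inspan n u (w j).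
  have ex : exists i, `[< ~ inspan n u (w i) >].
    by have [i wi] := not_inspan uo; exists i; apply/asboolP.
  case: (ex_minnP ex) => i /asboolP wi imin; exists i => // j ji.
  by apply: contrapT => wj; move: ji; rewrite ltnNge imin//; apply/asboolP.
have ni : (n <= i)%N by rewrite leqNgt; apply/negP => /uw.
have [c [vo vi]] := gram_schmidt_step uo (wL i) wi.
exists (fun x => c * (w i x - proj n u (w i) x)); split => // j.
rewrite ltnS leq_eqVlt; have [ij|ij] := eqVneq j i; first by rewrite ij.
move=> jn; apply: (inspan_le (leqnSn n) uo vo) => //; first by move=> k ->.
apply: imin; rewrite ltn_neqAle ij/=.
by case/predU1P: jn => [->//|/ltnW/leq_trans]; apply.
Qed.

Lemma exists_orthonormal_basis : exists u, orthonormal_basis mu u.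
Proof.
have [next nextP] : exists next : nat -> (nat -> T -> R) -> T -> R,
    forall n u, good n u -> good n.+1 (ext n u (next n u)).
  have /choice[next nP] : forall nu : nat * (nat -> T -> R),
      exists f, good nu.1 nu.2 -> good nu.1.+1 (ext nu.1 nu.2 f).
    move=> [n u]; have [gu|gu] := pselect (good n u); last by exists (cst 0).
    by have [f gf] := ext_good gu; exists f.
  by exists (fun n u => next (n, u)) => n u; exact: (nP (n, u)).
pose U := fix U n := if n is m.+1 then ext m (U m) (next m (U m)) else fun=> cst (0 : R).
have gU n : good n (U n).
  by elim: n => [|n IHn]; [split=> //; split|exact: nextP].
have UU n m k : (k < n)%N -> (n <= m)%N -> U m k = U n k.
  move=> kn /subnK <-; elim: (m - n)%N => [//|j IHj].
  by rewrite addSn /= /ext IHj ltn_addl.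
(* [U n] matters only below n and later stages leave these entries unchanged, so the diagonal agrees
   with every stage. *)
pose u k := U k.+1 k.
have uU n k : (k < n)%N -> U n k = u k by move=> kn; rewrite /u (UU k.+1 n).
have uo n : orthonormal mu n u.
  by apply: orthonormal_ext (proj1 (gU n)) => k; exact: uU.
have uw n i : (i < n)%N -> inspan n u (w i).
  move=> /(proj2 (gU n)); apply: (inspan_le (leqnn n) (proj1 (gU n)) (uo n)) => // k.
  exact: uU.
have uL k : u k \in L2 by have [uL _] := uo k.+1; exact: uL.
exists u; split => // [m n|f fL].
  by have [_ uo'] := uo (maxn m n).+1; rewrite uo'// ltnS ?leq_maxl ?leq_maxr.
pose D n := dot f f - \sum_(k < n) dot f (u k) ^+ 2.
have rL n : (fun x => f x - proj n u f x) \in L2 by apply: Lfun2B => //; exact: Lfun2_projn.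
have D0 n : 0 <= D n by rewrite /D -(dist_projn (uo n))// L2dot_ge0.
have -> : (fun n => 'N[mu]_2%:E[EFin \o
    (fun x => f x - \sum_(k < n) dot f (u k) * u k x)%R]%E) =
    fun n => (Num.sqrt (D n))%:E.
  apply/funext => n; rewrite /D -(dist_projn (uo n))//.
  by rewrite -Lnorm2E//; [case/Lfun2P : (rL n)|case/Lfun2P : (rL n)].
apply: cvg_EFin; first exact: nearW.
apply/cvgrPdist_lt => eps e0; have e20 : 0 < eps ^+ 2 by rewrite exprn_gt0.
have [g gs gf] := wtot fL e20.
have [N gN] := lspan_inspan wL gs; near=> n.
rewrite /= sub0r normrN ger0_norm ?sqrtr_ge0// -[ltRHS]ger0_norm ?ltW//.
rewrite -[ltRHS]sqrtr_sqr ltr_sqrt//; apply: le_lt_trans gf.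
apply: dist_projn_inspan => //; first exact: lspan_Lfun2 gs.
apply: gN => // k kN; apply: uw; apply: leq_trans kN _.
by near: n; exact: nbhs_infty_ge.
Unshelve. all: by end_near. Qed.

End basis.

End gram_schmidt.

(** * Separability of L^2 *)

Section countable_generation.

(** One inclusion suffices, the other following from measurability of the generators. *)
Definition countably_generated d (T : measurableType d) :=
  exists G : nat -> set T, (forall n, measurable (G n)) /\ measurable `<=` <<s range G >>.

Lemma countably_generated_family d (T : measurableType d) (I : countType) (F : I -> set T) :
  (forall i, measurable (F i)) -> measurable `<=` <<s range F >> -> countably_generated T.
Proof.
move=> mF TF; exists (fun n => if unpickle n is Some i then F i else set0); split.
  by move=> n; case: unpickle => // i; exact: mF.
apply: (subset_trans TF); apply: sub_smallest2r; first exact: smallest_sigma_algebra.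
move=> _ [i _ <-].
by exists (pickle i) => //=; rewrite pickleK.
Qed.

Lemma sub_sigma_algebra_preimage (S : Type) (T : pointedType) (f : S -> T)
    (G : set (set T)) (H : set (set S)) (A : set T) : (forall B, G B -> H (f @^-1` B)) -> <<s G >> A -> <<s H >> (f @^-1` A).
Proof.
move=> GH GA.
have : <<s preimage_set_system setT f G >> (f @^-1` A).
  by rewrite g_sigma_preimageE; exists A => //; rewrite setTI.
apply: sub_smallest2r; first exact: smallest_sigma_algebra.
by move=> _ [B GB <-]; rewrite setTI; exact: GH.
Qed.

Lemma countably_generated_prod d1 d2 (T1 : measurableType d1) (T2 : measurableType d2) :
  countably_generated T1 -> countably_generated T2 ->
  countably_generated (T1 * T2)%type.
Proof.
move=> [G1 [mG1 TG1]] [G2 [mG2 TG2]].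
pose F (i : nat + nat) : set (T1 * T2) :=
  match i with inl n => fst @^-1` G1 n | inr n => snd @^-1` G2 n end.
apply: (@countably_generated_family _ _ _ F) => [[n|n]|].
- by rewrite -[X in measurable X]setTI; exact: measurable_fst.
- by rewrite -[X in measurable X]setTI; exact: measurable_snd.
apply: smallest_sub; first exact: smallest_sigma_algebra.
move=> _ [] [A mA <-]; rewrite setTI.
- by apply: sub_sigma_algebra_preimage (TG1 _ mA) => _ [n _ <-]; exists (inl n).
- by apply: sub_sigma_algebra_preimage (TG2 _ mA) => _ [n _ <-]; exists (inr n).
Qed.

Lemma countably_generated_tuple d (T : measurableType d) n :
  countably_generated T -> countably_generated (n.-tuple T).
Proof.
move=> [G [mG TG]].
pose F (i : 'I_n * nat) : set (n.-tuple T) := (@tnth _ T ^~ i.1) @^-1` G i.2.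
apply: (@countably_generated_family _ _ _ F) => [[i k]|].
  by rewrite -[X in measurable X]setTI; exact: measurable_tnth.
apply: smallest_sub; first exact: smallest_sigma_algebra.
rewrite -bigcup_seq => _ [i _ [A mA <-]]; rewrite setTI.
by apply: sub_sigma_algebra_preimage (TG _ mA) => _ [k _ <-]; exists (i, k).
Qed.

Lemma countably_generated_bool : countably_generated bool.
Proof.
apply: (@countably_generated_family _ bool bool (fun b => [set b])) => // A _.
change (@measurable _ (g_sigma_algebraType (range (fun b : bool => [set b]))) A).
have mb (b : bool) : @measurable _ (g_sigma_algebraType (range (fun b : bool => [set b]))) [set b].
  by apply: sub_sigma_algebra; exists b.
have -> : A = \bigcup_(b in A) [set b].
  by apply/seteqP; split => [b Ab|b [_ Ab ->]//]; exists b.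
by apply: fin_bigcup_measurable => //; exact: finite_finset.
Qed.

Lemma countably_generated_R (R : realType) : countably_generated (measurableTypeR R).
Proof.
pose F (q : rat) : set (measurableTypeR R) := `]ratr q, +oo[%classic.
apply: (@countably_generated_family _ _ _ F) => [q|A].
  exact: measurable_itv.
rewrite /measurable /= => mA.
have : (@RGenOInfty.G R).-sigma.-measurable A by rewrite -RGenOInfty.measurableE.
apply: smallest_sub; first exact: smallest_sigma_algebra.
move=> _ [x ->].
change (@measurable _ (g_sigma_algebraType (range F)) `]x, +oo[%classic).
have -> : `]x, +oo[%classic = \bigcup_(q in [set q : rat | x < ratr q]) F q.
  apply/seteqP; split => [y /=|y [q /= xq]].
    rewrite in_itv/= andbT => xy; have [q] := rat_in_itvoo xy.
    by rewrite in_itv/= => /andP[xq qy]; exists q => //=; rewrite /F/= in_itv/= qy.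
  by rewrite /F/= !in_itv/= !andbT; exact: lt_trans.
rewrite bigcup_mkcond; apply: bigcupT_measurable_rat => q; case: ifPn => // _.
by apply: sub_sigma_algebra; exists q.
Qed.

End countable_generation.

(** * Density of the span of the indicators of a generating pi-system *)

Section density.
Context {d} {T : measurableType d} {R : realType}.
Variable mu : probability T R.
Local Notation L2 := (Lfun mu 2%:E).
Local Notation dot := (L2dot mu).
Implicit Types f g h : T -> R.
Local Notation dist2 f g := (dot (fun x => f x - g x) (fun x => f x - g x)).

Lemma L2dotDr f g h : f \in L2 -> g \in L2 -> h \in L2 ->
  dot h (fun x => f x + g x) = dot h f + dot h g.
Proof. by move=> *; rewrite ![dot h _]L2dotC L2dotDl. Qed.

Lemma L2dot_add_le f g : f \in L2 -> g \in L2 ->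
  dot (fun x => f x + g x) (fun x => f x + g x) <= 2 * dot f f + 2 * dot g g.
Proof.
move=> fL gL; have := L2dot_ge0 mu (fun x => f x - g x).
have fgL := Lfun2D fL gL.
by rewrite L2dot_subsub// L2dotDl// !L2dotDr// [dot g f]L2dotC; lra.
Qed.

Section closure.
Variable w : nat -> T -> R.
Hypothesis wL : forall k, w k \in L2.

(** The closure of [lspan w] in L^2. It is shown to contain ever more functions until it is
    everything. *)
Let V f := f \in L2 /\ forall eps : R, 0 < eps ->
  exists2 g, lspan w g & dist2 f g < eps.

Let V_lspan g : lspan w g -> V g.
Proof.
move=> gs; split; first exact: lspan_Lfun2 gs.
move=> eps e0; exists g => //; rewrite /L2dot.
by under eq_Rintegral do rewrite subrr mul0r; rewrite Rintegral_cst// mul0r.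
Qed.

Let V_lim f : f \in L2 -> (forall eps : R, 0 < eps -> exists2 g, V g & dist2 f g < eps) -> V f.
Proof.
(* Since |a + b|^2 <= 2 |a|^2 + 2 |b|^2, two squared errors below eps / 4 add up to less than
   eps. *)
move=> fL fV; split=> // eps e0; have e4 : 0 < eps / 4 by rewrite divr_gt0.
have [g [gL gV] fg] := fV _ e4; have [h hs gh] := gV _ e4.
have hL := lspan_Lfun2 wL hs; exists h => //.
have -> : (fun x => f x - h x) = fun x => (f x - g x) + (g x - h x).
  by apply/funext => x; rewrite addrA subrK.
by apply: le_lt_trans (L2dot_add_le (Lfun2B fL gL) (Lfun2B gL hL)) _; lra.
Qed.

Let V_D f g : V f -> V g -> V (fun x => f x + g x).
Proof.
move=> [fL fV] [gL gV]; split=> [|eps e0]; first exact: Lfun2D.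
have e4 : 0 < eps / 4 by rewrite divr_gt0.
have [f' [s fs] ff] := fV _ e4; have [g' [t gt] gg] := gV _ e4.
have f'L : f' \in L2 by apply: (lspan_Lfun2 wL); exists s.
have g'L : g' \in L2 by apply: (lspan_Lfun2 wL); exists t.
exists (fun x => f' x + g' x).
  by exists (s ++ t); apply/funext => x; rewrite big_cat fs gt.
have -> : (fun x => f x + g x - (f' x + g' x)) = fun x => (f x - f' x) + (g x - g' x).
  by apply/funext => x; ring.
by apply: le_lt_trans (L2dot_add_le (Lfun2B fL f'L) (Lfun2B gL g'L)) _; lra.
Qed.

Let V_Z c f : V f -> V (fun x => c * f x).
Proof.
move=> [fL fV]; split=> [|eps e0]; first exact: Lfun2Z.
(* The summand 1 keeps the divisor positive when c = 0. *)
have c0 : 0 < c ^+ 2 + 1 by rewrite ltr_wpDl ?sqr_ge0.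
have [f' [s fs] ff] := fV _ (divr_gt0 e0 c0).
have f'L : f' \in L2 by apply: (lspan_Lfun2 wL); exists s.
exists (fun x => c * f' x).
  exists [seq (c * p.1, p.2) | p <- s]; apply/funext => x.
  by rewrite fs big_map mulr_sumr; apply: eq_bigr => p _; rewrite mulrA.
have -> : (fun x => c * f x - c * f' x) = fun x => c * (f x - f' x).
  by apply/funext => x; rewrite mulrBr.
have ffL := Lfun2B fL f'L.
rewrite L2dotZl ?L2dotZr ?Lfun2Z// mulrA -expr2.
move: ff; rewrite ltr_pdivlMr// => /(le_lt_trans _); apply.
by rewrite mulrC ler_wpM2l ?L2dot_ge0// lerDl.
Qed.

(** Under domination, pointwise convergence gives convergence in L^2, because (f - F n)^2 <= 4
    h^2. *)
Let V_domlim (F : nat -> T -> R) f h : (forall n, V (F n)) -> measurable_fun setT f ->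
  (forall x, F ^~ x @ \oo --> f x) -> h \in L2 -> (forall n x, `|F n x| <= h x) -> V f.
Proof.
move=> FV mf Ff hL Fh.
have fh x : `|f x| <= h x.
  by apply: (cvgr_to_le (cvg_norm (Ff x))); exact: nearW.
have fL : f \in L2.
  apply/Lfun2P; split => //; apply: le_integrableR (Lfun2_integrable_sqr hL).
    exact: measurable_funX.
  by move=> x; rewrite normrX lerXn2r// nnegrE (le_trans _ (fh x)).
apply: V_lim => // eps e0.
have : \int[mu]_x ((f x - F n x) * (f x - F n x)) @[n --> \oo] --> \int[mu]_x (cst 0 x : R).
  apply: (cvg_Rintegral (g := fun x => 4 * h x ^+ 2)).
  - move=> n; have mF := Lfun2_measurable (proj1 (FV n)).
    by apply: measurable_funM; exact: measurable_funB.
  - exact: measurable_cst.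
  - move=> x; rewrite -[X in _ --> X](mulr0 (f x - f x)) -[X in _ * X](subrr (f x)).
    by apply: cvgM; apply: cvgB => //; exact: cvg_cst.
  - by apply: integrableZR; exact: Lfun2_integrable_sqr.
  move=> n x; rewrite -expr2 normrX.
  have -> : 4 * h x ^+ 2 = (2 * h x) ^+ 2 by ring.
  have h0 : 0 <= h x by exact: le_trans (normr_ge0 _) (fh x).
  rewrite lerXn2r ?nnegrE ?mulr_ge0// (le_trans (ler_normB _ _))//.
  by rewrite mulr2n mulrDl !mul1r lerD.
rewrite Rintegral_cst// mul0r => /cvgrPdist_lt /(_ _ e0) [N _ NF].
exists (F N); first exact: FV.
by have := NF N (leqnn N); rewrite /= sub0r normrN; apply: le_lt_trans; exact: ler_norm.
Qed.

(** A pi-lambda argument: complements come from linearity, and countable disjoint unions from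
    dominated limits of finite sums of indicators. *)
Let V_indic (G : set (set T)) : @measurable _ T = <<s G >> -> setI_closed G ->
  G setT -> (forall A, G A -> V (\1_A)) -> forall A, measurable A -> V (\1_A).
Proof.
move=> GE GI GT GV A; rewrite GE.
apply: (@dynkin_induction _ _ G (fun A => V (\1_A))) => //; first exact: GV.
- move=> S mS VS.
  have -> : \1_(~` S) = (fun x => \1_setT x + (-1) * \1_S x) :> (T -> R).
    by apply/funext => x; rewrite !indicE in_setC in_setT; case: (x \in S) => /=; ring.
  by apply: V_D; [exact: GV|exact: V_Z].
move=> F mF tF VF.
apply: (@V_domlim (fun n => \1_(\big[setU/set0]_(i < n) F i)) _ (cst 1)).
- elim=> [|n IHn].
    rewrite big_ord0 indic0; have := V_Z 0 (VF 0%N).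
    by rewrite (_ : (fun _ => _) = cst 0)//; apply/funext => x; rewrite mul0r.
  rewrite big_ord_recr/=; set U := \big[_/_]_(i < n) _ in IHn *.
  have UF x : U x -> F n x -> False.
    rewrite /U -bigcup_mkord => -[i /= ilt Fix] Fnx.
    by have := tF i n I I (ex_intro _ x (conj Fix Fnx)) => ie; rewrite ie ltnn in ilt.
  have -> : \1_(U `|` F n) = (fun x => \1_U x + \1_(F n) x) :> (T -> R).
    apply/funext => x; rewrite !indicE in_setU.
    have [Ux|_] := boolP (x \in U); have [Fx|_] := boolP (x \in F n); rewrite /= ?addr0 ?add0r//.
    by case: (UF x (set_mem Ux) (set_mem Fx)).
  exact: V_D.
- by apply: measurable_indic; exact: bigcup_measurable.
- move=> x; apply: cvg_near_cst; have [[k _ Fkx]|nF] := pselect ((\bigcup_k F k) x).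
    near=> n; rewrite !indicE !mem_set//; first by exists k.
    by rewrite -bigcup_mkord; exists k => //=; near: n; exact: nbhs_infty_gt.
  near=> n; rewrite !indicE !memNset// -bigcup_mkord => -[i _ Fix]; apply: nF.
  by exists i.
- exact: Lfun_cst.
- by move=> n x; rewrite indicE ger0_norm//; case: (_ \in _); rewrite ?lexx ?ler01.
Unshelve. all: by end_near. Qed.

Import HBNNSimple.

Let V_all : (forall A, measurable A -> V (\1_A)) -> total_family mu w.
Proof.
move=> w_dense.
suff VL : forall f, f \in L2 -> V f by move=> f /VL[].
have V0 : V (cst 0).
  have -> : cst 0 = \1_set0 :> (T -> R) by rewrite indic0.
  exact: w_dense.
have Vge0 f : f \in L2 -> (forall x, 0 <= f x) -> V f.
  move=> fL f0; have mf := Lfun2_measurable fL.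
  have mEf : measurable_fun setT (EFin \o f) by exact/measurable_EFinP.
  have fe0 x : setT x -> (0 <= (EFin \o f) x)%E by move=> _; rewrite lee_fin.
  pose F := nnsfun_approx measurableT mEf.
  apply: (@V_domlim (fun n x => F n x) f f) => //.
  - move=> n.
    have [k [c [A [mA FE]]]] : exists k (c : 'I_k -> R) (A : 'I_k -> set T),
        (forall i, measurable (A i)) /\ forall x, F n x = \sum_(i < k) c i * \1_(A i) x.
      by do 3 eexists; split; last exact: fimfunEord.
    have -> : (fun x => F n x) = fun x => \sum_(i < k) c i * \1_(A i) x.
      by apply/funext => x; exact: FE.
    elim: k c A mA {FE} => [|k IHk] c A mA.
      by rewrite (_ : (fun _ => _) = cst 0)//; apply/funext => x; rewrite big_ord0.
    rewrite (_ : (fun _ => _) = fun x => \sum_(i < k) c (widen_ord (leqnSn k) i) *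
        \1_(A (widen_ord (leqnSn k) i)) x + c ord_max * \1_(A ord_max) x).
      by apply: V_D; [exact: IHk|apply: V_Z; exact: w_dense].
    by apply/funext => x; rewrite big_ord_recr.
  - move=> x; have := @cvg_nnsfun_approx _ _ _ _ measurableT _ mEf fe0 x I.
    by move/fine_cvg.
  move=> n x; rewrite ger0_norm//.
  rewrite /F nnsfun_approxE.
  by have := @le_approx _ _ _ setT (EFin \o f) n x fe0 I; rewrite lee_fin.
move=> f fL; have mf := Lfun2_measurable fL.
have fpL : (fun x => Num.max (f x) 0) \in L2.
  apply/Lfun2P; split; first exact: measurable_maxr.
  apply: le_integrableR (Lfun2_integrable_sqr fL).
    by apply: measurable_funX; exact: measurable_maxr.
  move=> x; rewrite normrX -[leRHS]real_normK ?num_real// lerXn2r// ?nnegrE//.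
  by case: (lerP (f x) 0) => ?; rewrite ?normr0.
have fnL : (fun x => Num.max (f x) 0 - f x) \in L2 by exact: Lfun2B.
(* Difference of the positive and negative parts, each nonnegative and in L^2. *)
have -> : f = fun x => Num.max (f x) 0 + (-1) * (Num.max (f x) 0 - f x).
  by apply/funext => x; ring.
apply: V_D; [|apply: V_Z]; apply: Vge0 => // x.
  by rewrite le_max lexx orbT.
by rewrite subr_ge0 le_max lexx.
Qed.

Lemma total_family_of_generator (G : set (set T)) : @measurable _ T = <<s G >> ->
  setI_closed G -> G setT -> (forall A, G A -> exists k, w k = \1_A) -> total_family mu w.
Proof.
move=> GE GI GT GV; apply: V_all => A; apply: (V_indic GE GI GT) => {}A /GV [k <-].
apply: V_lspan; exists [:: (1, k)]; apply/funext => x.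
by rewrite big_seq1 mul1r.
Qed.

End closure.

(** Finite intersections of the generators form a pi-system indexed by the countable type [seq nat];
    the empty list contributes the whole space. *)
Lemma exists_total_family : countably_generated T ->
  exists w : nat -> T -> R, (forall k, w k \in L2) /\ total_family mu w.
Proof.
move=> [G [mG TG]].
pose A (s : seq nat) := foldr (fun i B => G i `&` B) setT s.
have mA s : measurable (A s) by elim: s => //= i s IHs; exact: measurableI.
have AI s t : A s `&` A t = A (s ++ t).
  by elim: s => [|i s IHs]; [rewrite setTI|rewrite /= -IHs setIA].
pose w k : T -> R := \1_(A (odflt [::] (unpickle k))).
have wL k : w k \in L2.
  apply: (bounded_Lfun2 mu (C := 1)); first exact: measurable_indic.
  by move=> x; rewrite /w indicE ger0_norm//; case: (_ \in _); rewrite ?lexx ?ler01.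
exists w; split => //; apply: (total_family_of_generator wL (G := range A)).
- apply/seteqP; split.
    apply: (subset_trans TG); apply: sub_smallest2r; first exact: smallest_sigma_algebra.
    by move=> _ [i _ <-]; exists [:: i] => //=; rewrite setIT.
  apply: smallest_sub; first exact: sigma_algebra_measurable.
  by move=> _ [s _ <-]; exact: mA.
- by move=> _ _ [s _ <-] [t _ <-]; exists (s ++ t).
- by exists [::].
- by move=> _ [s _ <-]; exists (pickle s); rewrite /w pickleK.
Qed.

End density.

(** * Orthonormal eigenfunctions *)

Section eigenspaces.
Context {dX dY} {X : measurableType dX} {Y : measurableType dY} {R : realType}.
Variables (mu : probability X R) (rho : probability Y R) (phi : X -> Y -> R).
Hypothesis bphi : bounded_kernel phi.
Let K : X -> X -> R := kcomp rho phi (fun s x => phi x s).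
Local Notation L2 := (Lfun mu 2%:E).
Local Notation dot := (L2dot mu).
Local Notation T := (integral_operator mu K).

Let bK : bounded_kernel K := bounded_gram mu rho bphi.

Lemma ae_eq_inspan n u (f g : X -> R) : orthonormal mu n u -> f \in L2 -> g \in L2 ->
  {ae mu, forall x, f x = g x} -> inspan mu n u g -> inspan mu n u f.
Proof.
move=> uo fL gL fg; have [uL _] := uo.
have E : projn mu n u f = projn mu n u g.
  apply/funext => x; apply: eq_bigr => k _; congr (_ * _).
  apply: ae_eq_L2dot fg _ => //; [exact: uL|exact: uL|exact: aeW].
by rewrite /inspan E; apply: filterS2 fg => x ->.
Qed.

Lemma inspan_sum n u k (c : 'I_k -> R) (F : 'I_k -> X -> R) : orthonormal mu n u ->
  (forall i, F i \in L2) -> (forall i, inspan mu n u (F i)) ->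
  inspan mu n u (fun x => \sum_(i < k) c i * F i x).
Proof.
move=> uo FL Fu; elim: k c F FL Fu => [|k IHk] c F FL Fu.
  apply: aeW => x; rewrite big_ord0 /projn big1// => i _.
  rewrite /L2dot; under eq_Rintegral do rewrite big_ord0 mul0r.
  by rewrite Rintegral_cst// !mul0r.
rewrite (_ : (fun _ => _) = fun x => \sum_(i < k) c (widen_ord (leqnSn k) i) *
    F (widen_ord (leqnSn k) i) x + c ord_max * F ord_max x).
  apply: inspanD => //; [exact: Lfun2_lin|exact: Lfun2Z| |exact: inspanZ].
  by apply: (IHk (fun i => c (widen_ord (leqnSn k) i))).
by apply/funext => x; rewrite big_ord_recr.
Qed.

Lemma eigenspace_residual l (f : X -> R) n u c : orthonormal mu n u ->
  (forall k, (k < n)%N -> in_eigenspace mu T l (u k)) -> in_eigenspace mu T l f ->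
  in_eigenspace mu T l (fun x => c * (f x - projn mu n u f x)).
Proof.
move=> uo ue [fL fe]; have pL := Lfun2_projn f uo; have fpL := Lfun2B fL pL.
split; first exact: Lfun2Z.
(* Finitely many null sets are merged, so that all the equations are available at one and the same
   x. *)
have ue' : {ae mu, forall x, forall k : 'I_n, T (u k) x = l * u k x}.
  by apply: filter_forall => k; case: (ue k (ltn_ord k)).
apply: filterS2 fe ue' => x fx ux.
have uL (k : 'I_n) : u k \in L2 by case: (ue k (ltn_ord k)).
have KL h : h \in L2 -> mu.-integrable setT (EFin \o (fun y => K x y * h y)).
  by move=> hL; apply: kop_integrable => //; exact: Lfun2_integrable.
have -> : T (fun x => c * (f x - projn mu n u f x)) x =
    c * (T f x - \sum_(k < n) dot f (u k) * T (u k) x).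
  rewrite /integral_operator.
  under eq_Rintegral do rewrite mulrCA.
  rewrite RintegralZl//; last exact: (KL _ fpL).
  congr (_ * _); under eq_Rintegral do rewrite mulrBr.
  rewrite RintegralB//; [|exact: KL|exact: (KL _ pL)].
  congr (_ - _); under eq_Rintegral do rewrite /projn mulr_sumr.
  rewrite Rintegral_sum => [|k]; last first.
    exact: (KL _ (Lfun2Z (dot f (u k)) (uL k))).
  apply: eq_bigr => k _; under eq_Rintegral do rewrite mulrCA.
  by rewrite RintegralZl//; exact: KL.
rewrite fx mulrCA; congr (_ * _); rewrite mulrBr; congr (_ - _).
by rewrite /projn mulr_sumr; apply: eq_bigr => k _; rewrite ux mulrCA.
Qed.

(** Gram-Schmidt is run through the given basis, skipping vectors already in the span. This yields m
    <= n vectors, and freeness of the basis forces m = n. *)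
Lemma eigenspace_orthonormal l n : has_multiplicity mu T l n ->
  exists u, [/\ orthonormal mu n u, forall k, (k < n)%N -> in_eigenspace mu T l (u k) &
    forall f, in_eigenspace mu T l f -> (forall k, (k < n)%N -> dot f (u k) = 0) ->
      {ae mu, forall x, f x = 0}].
Proof.
move=> [e [ee efree espan]].
have eL i : e i \in L2 by case: (ee i).
have [m [u [mn uo ue us]]] : exists m u, [/\ (m <= n)%N, orthonormal mu m u,
    forall k, (k < m)%N -> in_eigenspace mu T l (u k) & forall i : 'I_n, inspan mu m u (e i)].
  suff H j : (j <= n)%N -> exists m u, [/\ (m <= j)%N, orthonormal mu m u,
      forall k, (k < m)%N -> in_eigenspace mu T l (u k) &
      forall i : 'I_n, (i < j)%N -> inspan mu m u (e i)].
    have [m [u [mn uo ue us]]] := H n (leqnn n).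
    by exists m, u; split => // i; exact: us.
  elim: j => [_|j IHj jn]; first by exists 0%N, (fun=> cst 0); split => //; split.
  have [m [u [mj uo ue us]]] := IHj (ltnW jn).
  have [ej|ej] := pselect (inspan mu m u (e (Ordinal jn))).
    exists m, u; split => // [|i]; first exact: leqW.
    rewrite ltnS leq_eqVlt => /predU1P[ij|]; last exact: us.
    by rewrite (_ : i = Ordinal jn)//; exact: val_inj.
  have [c [vo vi]] := gram_schmidt_step uo (eL _) ej.
  do 2 eexists; split; [|exact: vo| |]; first by rewrite ltnS.
    move=> k; rewrite ltnS leq_eqVlt => /predU1P[->|km].
      by rewrite ltnn; exact: eigenspace_residual.
    by rewrite km; exact: ue.
  move=> i; rewrite ltnS leq_eqVlt => /predU1P[ij|ij].
    by rewrite (_ : i = Ordinal jn)//; exact: val_inj.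
  by apply: (inspan_le (leqnSn m) uo vo) => [k ->//| |]; [exact: eL|exact: us].
have [uL _] := uo.
have mE : m = n.
  (* If m < n, the n by m matrix of coefficients has a nonzero row a with a A = 0; the combination
     of the [e i] with coefficients a then vanishes almost everywhere, against freeness. *)
  apply/eqP; rewrite eqn_leq mn leqNgt; apply/negP => ltmn.
  pose A : 'M[R]_(n, m) := \matrix_(i, k) dot (e i) (u k).
  have : kermx A != 0.
    by rewrite kermx_eq0 /row_free neq_ltn (leq_ltn_trans (rank_leq_col A)).
  case/rowV0Pn => a /sub_kermxP aA /eqP; apply; apply/rowP => i; rewrite mxE.
  move: i; apply: (efree (fun i => a 0 i)).
  have gs := inspan_sum (fun i => a 0 i) uo eL us.
  apply: filterS gs => x ->; rewrite /projn big1// => k _.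
  rewrite L2dot_suml//; last exact: uL.
  have /rowP/(_ k) := aA; rewrite !mxE => aAk.
  rewrite (_ : \sum_(i < n) _ = 0) ?mul0r// -[RHS]aAk.
  by apply: eq_bigr => i _; rewrite mxE.
rewrite mE in uo ue us; exists u; split => // f fe f0.
have [a fa] := espan f fe; have fL : f \in L2 by case: fe.
apply: (inspan_orth uo fL _ f0); apply: (ae_eq_inspan uo fL _ fa); first exact: Lfun2_lin.
exact: inspan_sum.
Qed.

(** Symmetry: l <f, g> and l' <f, g> are both equal to <B f, B g>. *)
Lemma gram_eigen_orth l l' f g : in_eigenspace mu T l f -> in_eigenspace mu T l' g ->
  l != l' -> dot f g = 0.
Proof.
move=> [fL fe] [gL ge] ll'; apply/eqP; rewrite -(mulrI_eq0 _ (@mulfI _ (l - l') _)) ?subr_eq0//.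
have TfL : kop mu K f \in L2 by apply: kop_Lfun2 => //; exact: Lfun2_integrable.
have TgL : kop mu K g \in L2 by apply: kop_Lfun2 => //; exact: Lfun2_integrable.
have H1 : l * dot f g = dot (kop mu K f) g.
  rewrite -L2dotZl//; apply: ae_eq_L2dot => //; first exact: Lfun2Z.
    by apply: filterS fe => x <-.
  exact: aeW.
have H2 : l' * dot f g = dot (kop mu K g) f.
  rewrite -L2dotZr// L2dotC; apply: ae_eq_L2dot => //; first exact: Lfun2Z.
    by apply: filterS ge => x <-.
  exact: aeW.
by rewrite mulrBl H1 H2 !kop_gram_dot// [X in _ - X]L2dotC subrr.
Qed.

(** For each l, the occurrences of l in [lam] are in bijection with an orthonormal basis of its
    eigenspace, and e k is the basis vector matched with the occurrence k. Surjectivity of the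
    bijection gives completeness; different eigenvalues are orthogonal by [gram_eigen_orth]. *)
Lemma orthonormal_eigenfunctions lam : enumerates_nonzero_eigenvalues mu T lam ->
  exists e, [/\ forall n, orthonormal mu n e, forall k, in_eigenspace mu T (lam k) (e k) &
    forall l f, l != 0 -> in_eigenspace mu T l f ->
      (forall k, dot f (e k) = 0) -> {ae mu, forall x, f x = 0}].
Proof.
move=> [lam0 mult].
have /choice[t tP] (l : R) : exists t : nat * (nat -> X -> R) * (nat -> nat), l != 0 ->
    [/\ orthonormal mu t.1.1 t.1.2,
      forall k, (k < t.1.1)%N -> in_eigenspace mu T l (t.1.2 k),
      forall f, in_eigenspace mu T l f -> (forall k, (k < t.1.1)%N -> dot f (t.1.2 k) = 0) ->
      {ae mu, forall x, f x = 0} & set_bij [set k | lam k = l] `I_t.1.1 t.2].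
  (* The value 0 receives a dummy triple, its requirement being vacuous. *)
  have [->|l0] := eqVneq l 0; first by exists (0%N, fun=> cst 0, id).
  have [n /eigenspace_orthonormal[u [uo ue uc]] /card_set_bijP[j jb]] := mult l l0.
  by exists (n, u, j).
pose N k := (t (lam k)).1.1; pose U k := (t (lam k)).1.2; pose J k := (t (lam k)).2 k.
have JN k : (J k < N k)%N.
  by have [_ _ _ [jf _ _]] := tP _ (lam0 k); exact: (jf k).
pose e k := U k (J k).
have ee k : in_eigenspace mu T (lam k) (e k).
  by have [_ ue _ _] := tP _ (lam0 k); exact: ue.
exists e; split => //.
  move=> n; split=> [i _|i j _ _]; first by case: (ee i).
  have [lij|lij] := eqVneq (lam i) (lam j); last first.
    by rewrite (gram_eigen_orth (ee i) (ee j) lij); case: eqP => // ij; rewrite ij eqxx in lij.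
  have [[_ uo] _ _ [_ ji _]] := tP _ (lam0 i).
  have := JN j; have := JN i; rewrite /e /U /J /N -lij => iN jN; rewrite uo//.
  congr (_%:R); congr nat_of_bool; apply/eqP/eqP => [|->//].
  by apply: ji; rewrite inE.
move=> l f l0 fe f0; have [_ _ uc [_ _ js]] := tP _ l0.
apply: uc => // k kN; have [i /= il <-] := js k kN.
by have := f0 i; rewrite /e /U /J il.
Qed.

Theorem gram_trace_theorem lam : countably_generated X ->
  enumerates_nonzero_eigenvalues mu T lam ->
  [/\ forall k, 0 < lam k, series lam @ \oo --> \int[mu]_x K x x &
    has_trace mu T (\int[mu]_x K x x)].
Proof.
move=> Xcg lamE; have [lam0 _] := lamE.
have [e [eo ee ec]] := orthonormal_eigenfunctions lamE.
have [w [wL wt]] := exists_total_family mu Xcg.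
have [u ub] := exists_orthonormal_basis wL wt eo.
have eL k : e k \in L2 by case: (ee k).
have ek k : {ae mu, forall x, kop mu K (e k) x = lam k * e k x} by case: (ee k).
have e1 k : dot (e k) (e k) = 1 by have [_ ->//] := eo k.+1; rewrite eqxx.
have lamp k : 0 < lam k := gram_eigenvalue_gt0 bphi (lam0 k) (eL k) (ek k) (e1 k).
split => //; last first.
  split; first by exists u.
  by move=> u' u'b; exact: gram_trace_series.
(* the bounded, everywhere defined representative of e k *)
pose v k x := (lam k)^-1 * kop mu K (e k) x.
have vL k : v k \in L2.
  by apply: Lfun2Z; apply: kop_Lfun2 => //; exact: Lfun2_integrable.
have ve k : {ae mu, forall x, v k x = e k x}.
  by apply: filterS (ek k) => x; rewrite /v => ->; rewrite mulKf.
have vdot i f : f \in L2 -> dot f (v i) = dot f (e i).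
  by move=> fL; apply: ae_eq_L2dot (ve i) => //; exact: aeW.
apply: (gram_spectral_trace (v := v) bphi lamp _ _ _ ub).
- move=> n; split=> // i j ilt jlt; have [_ eo'] := eo n.
  by rewrite vdot// L2dotC vdot// L2dotC eo'.
- move=> k x; have -> : lam k * v k x = kop mu K (e k) x by rewrite /v mulVKf.
  apply: ae_eq_Rintegral.
  + by apply: measurable_funM; [exact: bounded_kernel_row|exact: Lfun2_measurable (vL k)].
  + by apply: measurable_funM; [exact: bounded_kernel_row|exact: Lfun2_measurable (eL k)].
  by apply: filterS (ve k) => y ->.
by move=> l h l0 hL Kh hv; apply: (ec l) => // k; rewrite -vdot.
Qed.

End eigenspaces.

(** * The corner kernel *)

Section cube_integrals.
Context {R : realType}.
Local Notation TR := (measurableTypeR R).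

(** Independence of the coordinates: [cube_prob] is an image of a product measure under
    [tuple_consf], so one coordinate splits off at each induction step. *)
Lemma cube_integral_prod d (h : 'I_d -> TR -> R) (C : R) :
  (forall k, measurable_fun setT (h k)) -> (forall k x, `|h k x| <= C) ->
  \int[cube_prob d]_s (\prod_(k < d) h k (tnth s k)) = \prod_(k < d) \int[unif01]_x h k x.
Proof.
elim: d h => [|d IHd] h mh hC.
  under eq_Rintegral do rewrite big_ord0.
  by rewrite big_ord0 Rintegral_cst// mul1r;
    exact: (congr1 fine (@probability_setT _ _ _ (cube_prob 0))).
have mprod n (g : 'I_n -> TR -> R) : (forall k, measurable_fun setT (g k)) ->
    measurable_fun setT (fun s : n.-tuple TR => \prod_(k < n) g k (tnth s k)).
  move=> mg; apply: measurable_prod => k _.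
  by apply: (measurableT_comp (mg k)); exact: measurable_tnth.
have bprod n (g : 'I_n -> TR -> R) (s : n.-tuple TR) : (forall k x, `|g k x| <= C) ->
    `|\prod_(k < n) g k (tnth s k)| <= C ^+ n.
  move=> gC; rewrite normr_prod -[n in leRHS]card_ord -prodr_const.
  by apply: ler_prod => k _; rewrite normr_ge0 gC.
have C0 : 0 <= C by exact: le_trans (normr_ge0 _) (hC ord0 0).
transitivity (\int[(unif01 \x cube_prob d)%E]_z
    (h ord0 z.1 * \prod_(k < d) h (lift ord0 k) (tnth z.2 k))).
  have E (z : TR * d.-tuple TR) : \prod_(k < d.+1) h k (tnth (tuple_consf z) k) =
      h ord0 z.1 * \prod_(k < d) h (lift ord0 k) (tnth z.2 k).
    by rewrite big_ord_recl; congr (_ * _); apply: eq_bigr => k _; rewrite tnthS.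
  rewrite /Rintegral /= integral_distribution.
  - by congr fine; apply: eq_integral => z _ /=; rewrite E.
  - by apply/measurable_EFinP; exact: mprod.
  apply: (bounded_integrable (unif01 \x cube_prob d)%E (C := C ^+ d.+1)).
    by apply: (measurableT_comp (mprod _ _ mh)); exact: measurable_tuple_consf.
  by move=> z; exact: bprod.
rewrite (Rintegral12_prod _ _ _ _ (cst (C * C ^+ d)))//.
- transitivity (\int[unif01]_x (h ord0 x *
      \int[cube_prob d]_s \prod_(k < d) h (lift ord0 k) (tnth s k))).
    apply: eq_Rintegral => x _; rewrite -RintegralZl//.
    by apply: (bounded_integrable _ (C := C ^+ d)) => [|s]; [exact: (mprod _ (fun k => h (lift ord0 k)))|
      exact: (bprod _ (fun k => h (lift ord0 k)))].
  rewrite RintegralZr//; last exact: (bounded_integrable unif01 (mh ord0) (hC ord0)).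
  by rewrite big_ord_recl (IHd (fun k => h (lift ord0 k))).
- apply: measurable_funM; first exact: (measurableT_comp (mh ord0)).
  exact: (measurableT_comp (mprod _ _ (fun k => mh (lift ord0 k)))).
- exact: finite_measure_integrable_cst.
by move=> x s; rewrite normrM ler_pM//; exact: (bprod _ (fun k => h (lift ord0 k))).
Qed.

(** [g] and [f] are compared on [0,1] only, because the closed form of [corner_marginal] is valid
    only there. *)
Lemma unif01_integral (f F : R -> R) : continuous f ->
  (forall x, is_derive x (1 : R) F (f x)) ->
  forall g : TR -> R, measurable_fun setT g -> (forall x, 0 <= g x) ->
  (forall x, x \in `[0, 1] -> g x = f x) -> \int[unif01]_x g x = F 1 - F 0.
Proof.
move=> cf dF g mg g0 gf.
rewrite /Rintegral integral_uniform; last 2 first.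
- exact/measurable_EFinP.
- by move=> x; rewrite lee_fin.
rewrite subr0 invr1 mul1e.
under eq_integral => x xI do rewrite (gf x (set_mem xI)).
rewrite (@continuous_FTC2 _ f F)//.
- by apply: continuous_subspaceT => x; exact: cf.
- have cF x : {for x, continuous F}.
    by apply: differentiable_continuous; apply/derivable1_diffP.
  split=> [x _||]; first by case: (dF x).
  + by apply: cvg_at_right_filter; exact: cF.
  + by apply: cvg_at_left_filter; exact: cF.
- by move=> x _; rewrite derive1E; exact: derive_val.
Qed.

End cube_integrals.

(** * The corner kernel as a Gram kernel *)

Section corner_kernel.
Context {R : realType} {d : nat}.
Local Notation TR := (measurableTypeR R).
Local Notation I := (index_space R d).
Local Notation P := (cube_prob (R := R) d).

(** The contribution of one coordinate to the indicator of A_j, real-valued so that the indicator is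
    a product and joint measurability in corner, point and s can be checked factor by factor. *)
Definition corner_factor (b : bool) (p x : TR) : R :=
  ((0 <= x <= 1) && (if b then p <= x else x <= p))%:R.

Lemma normr_corner_factor b p x : `|corner_factor b p x| <= 1.
Proof. by rewrite /corner_factor; case: (_ && _); rewrite /= ?normr1 ?normr0 ?ler01. Qed.

Lemma measurable_corner_factor dT (T : measurableType dT) (b : T -> bool) (p x : T -> TR) :
  measurable_fun setT b -> measurable_fun setT p -> measurable_fun setT x ->
  measurable_fun setT (fun t => corner_factor (b t) (p t) (x t)).
Proof.
move=> mb mp mx.
have mR : measurable_fun setT (fun c : bool => c%:R : R) by [].
apply: (measurableT_comp mR); apply: measurable_and.
  by apply: measurable_and; apply: measurable_fun_ler.
by apply: measurable_fun_ifT => //; exact: measurable_fun_ler.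
Qed.

Definition corner_indic (j : I) (s : d.-tuple TR) : R :=
  \prod_(k < d) corner_factor (tnth j.1 k) (tnth j.2 k) (tnth s k).

Lemma corner_indicE (j : I) : corner_indic j = \1_(anchored_box j).
Proof.
apply/funext => s; rewrite indicE /corner_indic.
have [/set_mem js|js] := boolP (s \in anchored_box j).
  rewrite big1// => k _; have [s01 sk] := js k.
  by rewrite /corner_factor s01; case: ifP sk => _ ->.
have [k nk] : exists k : 'I_d, ~ (0 <= tnth s k <= 1 /\
    (if tnth j.1 k then tnth j.2 k <= tnth s k else tnth s k <= tnth j.2 k)).
  by apply/existsNP => sj; case/negP: js; apply/mem_set.
rewrite (bigD1 k)//= /corner_factor; case: (boolP (_ && _)) => [/andP[s01 sk]|_].
  by exfalso; apply: nk; split.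
by rewrite mul0r.
Qed.

Lemma normr_corner_indic j s : `|corner_indic j s| <= 1.
Proof.
rewrite normr_prod; apply: prodr_ile1 => k _.
by rewrite normr_ge0 normr_corner_factor.
Qed.

Lemma bounded_corner_indic : bounded_kernel corner_indic.
Proof.
split; last first.
  by exists 1; exact: normr_corner_indic.
apply: measurable_prod => k _; apply: measurable_corner_factor.
- apply: (measurableT_comp (f := @tnth d bool ^~ k)); first exact: measurable_tnth.
  exact: measurableT_comp.
- apply: (measurableT_comp (f := @tnth d TR ^~ k)); first exact: measurable_tnth.
  exact: measurableT_comp.
- apply: (measurableT_comp (f := @tnth d TR ^~ k)); first exact: measurable_tnth.
  exact: measurable_snd.
Qed.

(** The box is the level set at 1 of its indicator, already known to be measurable as a product. *)
Lemma measurable_anchored_box (j : I) : measurable (anchored_box j).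
Proof.
have := bounded_kernel_row j bounded_corner_indic.
rewrite corner_indicE => /(_ measurableT [set 1] (measurable_set1 1)).
rewrite setTI (_ : \1_(anchored_box j) @^-1` [set 1] = anchored_box j)//.
apply/seteqP; split=> s /=; rewrite indicE.
  by case: (boolP (s \in _)) => [/set_mem//|_] /= /eqP; rewrite eq_sym oner_eq0.
by move=> js; rewrite mem_set.
Qed.

Definition corner_prob (j : I) : R := \int[P]_s corner_indic j s.

Lemma corner_probE j : corner_prob j = fine (P (anchored_box j)).
Proof.
rewrite /corner_prob corner_indicE /Rintegral integral_indic ?setIT//.
exact: measurable_anchored_box.
Qed.

Lemma measurable_corner_prob : measurable_fun setT corner_prob.
Proof.
apply: (measurable_Rintegral2 (nu d) P (fun z => corner_indic z.1 z.2) _ (cst 1)).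
- exact: (proj1 bounded_corner_indic).
- exact: finite_measure_integrable_cst.
- by move=> j s; exact: normr_corner_indic.
Qed.

Lemma normr_corner_prob j : `|corner_prob j| <= 1.
Proof.
apply: Rintegral_bound; last exact: normr_corner_indic.
exact: bounded_kernel_row bounded_corner_indic.
Qed.

Definition corner_feature (j : I) (s : d.-tuple TR) : R := corner_indic j s - corner_prob j.

Lemma bounded_corner_feature : bounded_kernel corner_feature.
Proof.
split.
  apply: measurable_funB; first exact: (proj1 bounded_corner_indic).
  exact: (measurableT_comp measurable_corner_prob).
exists 2 => j s; rewrite (le_trans (ler_normB _ _))// -[2]/(1 + 1 : R) lerD//.
  exact: normr_corner_indic.
exact: normr_corner_prob.
Qed.

(** [Kd j l] is the covariance of two indicators, hence the integral of the product of the centred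
    ones; the cross terms reduce because the total mass is 1. *)
Lemma KdE : Kd = kcomp P corner_feature (fun s j => corner_feature j s).
Proof.
apply/funext => j; apply/funext => l.
have IF i : P.-integrable setT (EFin \o corner_indic i).
  apply: (bounded_integrable P (C := 1)); last exact: normr_corner_indic.
  exact: bounded_kernel_row bounded_corner_indic.
have IFF : P.-integrable setT (EFin \o (fun s => corner_indic j s * corner_indic l s)).
  apply: (bounded_integrable P (C := 1)) => [|s].
    by apply: measurable_funM; exact: bounded_kernel_row bounded_corner_indic.
  by rewrite normrM -[1]mulr1 ler_pM//; exact: normr_corner_indic.
rewrite /Kd -!corner_probE.
have -> : fine (P (anchored_box j `&` anchored_box l)) =
    \int[P]_s (corner_indic j s * corner_indic l s).
  rewrite !corner_indicE /Rintegral.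
  under eq_integral => s _ do
    rewrite -[X in X%:E]/((\1_(anchored_box j) \* \1_(anchored_box l)) s) -indicI.
  rewrite integral_indic ?setIT//.
  by apply: measurableI; exact: measurable_anchored_box.
transitivity (\int[P]_s (corner_indic j s * corner_indic l s -
    (corner_prob j * corner_indic l s + (corner_prob l * corner_indic j s -
     corner_prob j * corner_prob l)))); last first.
  by apply: eq_Rintegral => s _; rewrite /corner_feature; ring.
have Ic : P.-integrable setT (EFin \o (fun s : d.-tuple TR => corner_prob j * corner_prob l)).
  exact: finite_measure_integrable_cst.
have I1 := integrableZR (corner_prob j) (IF l).
have I2 := integrableZR (corner_prob l) (IF j).
have I3 : P.-integrable setT (EFin \o (fun s => corner_prob l * corner_indic j s -
     corner_prob j * corner_prob l)) by exact: (integrableB _ I2 Ic).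
rewrite RintegralB//; last exact: integrableDR.
rewrite RintegralD// RintegralB//.
rewrite (RintegralZl _ measurableT (IF l)) (RintegralZl _ measurableT (IF j)).
rewrite Rintegral_cst// (_ : fine (P setT) = 1); last by rewrite probability_setT.
by rewrite -/(corner_prob l) -/(corner_prob j); ring.
Qed.

End corner_kernel.

(** * The moments of P_0(A_j) and the value of the trace *)

Section corner_integrals.
Context {R : realType}.
Local Notation TR := (measurableTypeR R).

Definition corner_marginal (b : bool) (p : TR) : R := \int[unif01]_x corner_factor b p x.

Lemma measurable_corner_factor2 b :
  measurable_fun setT (fun z : TR * TR => corner_factor b z.1 z.2).
Proof. exact: measurable_corner_factor. Qed.

Lemma measurable_corner_marginal b : measurable_fun setT (corner_marginal b).
Proof.
apply: (measurable_Rintegral2 unif01 unif01 (fun z => corner_factor b z.1 z.2) _ (cst 1)).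
- exact: measurable_corner_factor2.
- exact: finite_measure_integrable_cst.
- by move=> x y; exact: normr_corner_factor.
Qed.

Lemma normr_corner_marginal b p : `|corner_marginal b p| <= 1.
Proof.
apply: Rintegral_bound; last exact: normr_corner_factor.
exact: measurable_corner_factor.
Qed.

Lemma corner_marginal_ge0 b p : 0 <= corner_marginal b p.
Proof. by apply: Rintegral_ge0 => x _; rewrite /corner_factor ler0n. Qed.

Lemma corner_marginalE b p : p \in `[0, 1] -> corner_marginal b p = if b then 1 - p else p.
Proof.
rewrite in_itv/= => /andP[p0 p1].
rewrite /corner_marginal /Rintegral integral_uniform; last 2 first.
- by apply/measurable_EFinP; exact: measurable_corner_factor.
- by move=> x; rewrite lee_fin ler0n.
rewrite subr0 invr1 mul1e.
pose A : set R := if b then `[p, 1]%classic else `[0, p]%classic.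
have AE x : x \in `[0, 1]%classic -> (corner_factor b p x)%:E = (\1_A x)%:E.
  move=> /set_mem; rewrite /= in_itv/= => /andP[x0 x1].
  rewrite /corner_factor x0 x1 /= indicE /A; case: ifP => _.
    by rewrite mem_setE in_itv/= x1 andbT.
  by rewrite mem_setE in_itv/= x0.
under eq_integral => x xI do rewrite (AE x xI).
rewrite integral_indic//; last by rewrite /A; case: ifP.
have -> : A `&` `[0, 1] = A.
  apply/setIidPl; rewrite /A; case: ifP => _ x /=; rewrite !in_itv/= => /andP[h1 h2].
    by rewrite h2 andbT (le_trans p0).
  by rewrite h1 (le_trans h2).
rewrite /A; case: ifP => _.
  change (fine (@lebesgue_measure R [set` `[p, 1]]) = 1 - p).
  rewrite lebesgue_measure_itv/= lte_fin.
  by case: ltP => //= p1'; apply/esym/eqP; rewrite subr_eq0 eq_le p1 p1'.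
change (fine (@lebesgue_measure R [set` `[0, p]]) = p).
rewrite lebesgue_measure_itv/= lte_fin.
by case: ltP => //=; rewrite ?subr0// => p0'; apply/eqP; rewrite eq_le p0 p0'.
Qed.

Lemma is_derive_monomial n (x : R) :
  is_derive x (1 : R) (fun y : R => n.+1%:R^-1 * y ^+ n.+1) (x ^+ n).
Proof.
have -> : (fun y : R => n.+1%:R^-1 * y ^+ n.+1) = n.+1%:R^-1 *: (id : R -> R) ^+ n.+1.
  by apply/funext => y; rewrite !fctE.
apply: is_derive_eq; rewrite /GRing.scale/= mulr1 mulrA.
by rewrite mulVf ?pnatr_eq0// mul1r.
Qed.

Lemma is_derive_refl_monomial n (x : R) :
  is_derive x (1 : R) (fun y : R => - (n.+1%:R^-1 * (1 - y) ^+ n.+1)) ((1 - x) ^+ n).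
Proof.
have -> : (fun y : R => - (n.+1%:R^-1 * (1 - y) ^+ n.+1)) =
    - (n.+1%:R^-1 *: (cst 1 - (id : R -> R)) ^+ n.+1).
  by apply/funext => y; rewrite !fctE.
apply: is_derive_eq; rewrite /GRing.scale/= sub0r mulrN1 mulrN opprK mulrA.
by rewrite mulVf ?pnatr_eq0// mul1r.
Qed.

(** On [0,1] the marginal is p or 1 - p, and reflection leaves the moments unchanged. The cases n =
    1 and n = 2 are the source of the 2 and the 3 in the trace. *)
Lemma corner_marginal_moment b n :
  \int[unif01]_p (corner_marginal b p ^+ n) = n.+1%:R^-1.
Proof.
have mg : measurable_fun setT (fun p => corner_marginal b p ^+ n).
  by apply: measurable_funX; exact: measurable_corner_marginal.
have g0 p : 0 <= corner_marginal b p ^+ n by rewrite exprn_ge0 ?corner_marginal_ge0.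
case: b mg g0 => mg g0.
- rewrite (unif01_integral _ (is_derive_refl_monomial n) mg g0).
  + by rewrite subrr subr0 expr0n expr1n mulr0 mulr1 oppr0 sub0r opprK.
  + move=> x; apply: (@continuous_comp _ _ _ (fun y : R => 1 - y) (fun y : R => y ^+ n)).
      by apply: cvgB; [exact: cvg_cst|exact: cvg_id].
    exact: exprn_continuous.
  + by move=> p /corner_marginalE ->.
rewrite (unif01_integral _ (is_derive_monomial n) mg g0).
- by rewrite expr0n expr1n mulr0 mulr1 subr0.
- by move=> x; exact: exprn_continuous.
- by move=> p /corner_marginalE ->.
Qed.

Variable d : nat.
Local Notation I := (index_space R d).
Local Notation P := (cube_prob (R := R) d).

Lemma corner_prob_prod (j : I) :
  corner_prob j = \prod_(k < d) corner_marginal (tnth j.1 k) (tnth j.2 k).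
Proof.
apply: (cube_integral_prod (h := fun k => corner_factor (tnth j.1 k) (tnth j.2 k)) (C := 1)).
  by move=> k; exact: measurable_corner_factor.
by move=> k x; exact: normr_corner_factor.
Qed.

Lemma corner_prob_moment (c : d.-tuple bool) n :
  \int[P]_p (corner_prob (c, p) ^+ n) = n.+1%:R^-1 ^+ d.
Proof.
under eq_Rintegral do rewrite corner_prob_prod /= -prodrXl.
rewrite (cube_integral_prod (h := fun k p => corner_marginal (tnth c k) p ^+ n) (C := 1)).
- under eq_bigr do rewrite corner_marginal_moment.
  by rewrite prodr_const card_ord.
- by move=> k; apply: measurable_funX; exact: measurable_corner_marginal.
by move=> k x; rewrite normrX exprn_ile1 ?normr_corner_marginal.
Qed.

(** [nu] is matched with a scaled finite sum of product measures, along which integrals of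
    nonnegative functions split; the upper bound keeps each piece finite. *)
Lemma Rintegral_nu (f : I -> R) (C : R) : measurable_fun setT f ->
  (forall j, 0 <= f j <= C) ->
  \int[nu d]_j f j = 2 ^- d * \sum_(c : d.-tuple bool) \int[P]_p f (c, p).
Proof.
move=> mf fC; pose s := enum {: d.-tuple bool}; pose c0 : d.-tuple bool := [tuple of nseq d true].
pose m i : {measure set I -> \bar R} := (\d_(nth c0 s i) \x P)%E.
have k0 : 0 <= (2 ^- d : R) by rewrite invr_ge0 exprn_ge0.
pose k := NngNum k0.
have mEf : measurable_fun setT (EFin \o f) by exact/measurable_EFinP.
have f0 j : (0 <= (f j)%:E)%E by rewrite lee_fin; case/andP: (fC j).
have IP c : P.-integrable setT (EFin \o (fun p => f (c, p))).
  apply: (bounded_integrable P (C := C)); first exact: measurableT_comp.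
  by move=> p; case/andP: (fC (c, p)) => ? ?; rewrite ger0_norm.
rewrite /Rintegral (eq_measure_integral (mscale k (msum m (size s)))); last first.
  move=> A mA _; rewrite /nu /mscale /= /msum; congr (_ * _)%E.
  by rewrite -big_enum (big_nth c0) big_mkord.
rewrite ge0_integral_mscale// ge0_integral_measure_sum//.
have E i : (\int[m i]_j (f j)%:E = (\int[P]_p f (nth c0 s i, p))%:E)%E.
  rewrite /m fubini_tonelli1//= integral_dirac//; last first.
    exact: (measurable_fun_fubini_tonelli_F (EFin \o f)).
  by rewrite diracT mul1e fineK//; exact: integrable_fin_num (IP _).
under eq_bigr do rewrite E.
rewrite sumEFin /=; congr (_ * _).
by rewrite -[RHS]big_enum (big_nth c0) big_mkord.
Qed.

(** All 2^d corners give the same moment, so averaging with weight 2^-d leaves it unchanged. *)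
Lemma corner_prob_nu_moment n :
  \int[nu d]_j (corner_prob (R := R) (d := d) j ^+ n) = n.+1%:R^-1 ^+ d.
Proof.
rewrite (Rintegral_nu (C := 1)).
- under eq_bigr do rewrite corner_prob_moment.
  rewrite sumr_const card_tuple card_bool -[X in _ * X]mulr_natl natrX mulrA.
  by rewrite mulVf ?mul1r// expf_neq0.
- by apply: measurable_funX; exact: measurable_corner_prob.
move=> j; have p0 : 0 <= corner_prob j.
  by rewrite corner_prob_prod prodr_ge0// => k _; exact: corner_marginal_ge0.
by rewrite exprn_ge0//= exprn_ile1//; have := normr_corner_prob j; rewrite ger0_norm.
Qed.

Lemma Kd_diag (j : I) : Kd j j = corner_prob j - corner_prob j ^+ 2.
Proof. by rewrite /Kd setIid -corner_probE expr2. Qed.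

Lemma Rintegral_Kd_diag : \int[nu d]_j (Kd j j : R) = 2 ^- d - 3 ^- d.
Proof.
have mp : measurable_fun setT (corner_prob (R := R) (d := d)) := measurable_corner_prob.
under eq_Rintegral do rewrite Kd_diag.
rewrite RintegralB//.
- have := corner_prob_nu_moment 1; under eq_Rintegral do rewrite expr1; move=> ->.
  by rewrite corner_prob_nu_moment -!exprVn.
- by apply: (bounded_integrable (nu d) (C := 1)) => // j; exact: normr_corner_prob.
- apply: (bounded_integrable (nu d) (C := 1)); first exact: measurable_funX.
  by move=> j; rewrite normrX exprn_ile1 ?normr_corner_prob.
Qed.

End corner_integrals.

Theorem theoremC3 (R : realType) (d : nat) (lam : nat -> R) :
  (0 < d)%N ->
  enumerates_nonzero_eigenvalues (nu d) (@Td R d) lam ->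
  [/\ forall k, 0 <= lam k,
      series lam @ \oo --> \int[nu d]_j Kd j j,
      has_trace (nu d) (@Td R d) (\int[nu d]_j Kd j j)
    & \int[nu d]_j (Kd j j : R) = 2 ^- d - 3 ^- d].
Proof.
move=> _; rewrite /Td KdE => lamE.
have I_cg : countably_generated (index_space R d).
  apply: countably_generated_prod; apply: countably_generated_tuple.
    exact: countably_generated_bool.
  exact: countably_generated_R.
have [lam0 tr ht] := gram_trace_theorem bounded_corner_feature I_cg lamE.
by split => // [k|]; [exact: ltW|rewrite -KdE Rintegral_Kd_diag].
Qed.
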